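(* Let $\epsilon>0$ be the accuracy and let $1-\delta$, with $\delta>0$, be the required success probability. (1) For constant $k$, the sample complexity of quantum overlapping tomography of an $n$-qubit system, to succeed with probability at least $1-\delta$, is $$\Theta\!\left(\frac{\log(n/\delta)}{\epsilon^2}\right),$$ even using general joint measurement schemes. (2) For general $1\le k\le n$, quantum overlapping tomography can be accomplished by performing Pauli measurements on $$\mathcal{O}\!\left(\frac{10^k\,\log\!\big(\binom{n}{k}/\delta\big)}{\epsilon^2}\right)$$ copies of the state. (3) For partial quantum overlapping tomography with $M$ output density matrices, the sample complexity using Pauli measurements is $$\mathcal{O}\!\left(\frac{10^k\,\log(2M/\delta)}{\epsilon^2}\right).$$
   Context: An $n$-qubit mixed state (density matrix) is a positive semidefinite operator of trace $1$ on $(\mathbb{C}^2)^{\otimes n}$. For $S\subseteq\{1,\dots,n\}$, $\rho_S$ denotes the reduced density matrix of $\rho$ on the qubits in $S$, i.e. the partial trace of $\rho$ over the qubits not in $S$. $\|A\|_1=\operatorname{tr}\sqrt{A^\dagger A}$ is the trace norm. The constants implied by $\mathcal{O}(\cdot)$ are absolute; those implied by $\Theta(\cdot)$ in part (1) may depend on the constant $k$. Quantum overlapping tomography ($1\le k\le n$): given copies of an unknown $n$-qubit mixed state $\rho$, output density matrices $\sigma_S$ for all $S\subseteq\{1,\dots,n\}$ with $|S|\le k$ such that $\|\rho_S-\sigma_S\|_1<\epsilon$ for all such $S$, for a given $\epsilon>0$. The goal is to be achieved with probability at least $1-\delta$, for every $\rho$. Partial quantum overlapping tomography: the same problem when only $M$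 density matrices $\sigma_{S_1},\dots,\sigma_{S_M}$ are required, for given subsets $S_1,\dots,S_M$ with $|S_i|\le k$. That is, with probability at least $1-\delta$, $\|\rho_{S_i}-\sigma_{S_i}\|_1<\epsilon$ for all $i=1,\dots,M$. The sample complexity is the number of copies of $\rho$ needed to achieve the goal. A general joint measurement scheme on $m$ copies may perform an arbitrary measurement (POVM) on $\rho^{\otimes m}$, accessing all $mn$ qubits collectively, and computes its output from the outcome. Pauli measurements: for each copy of $\rho$ separately, each qubit $i$ is measured in the eigenbasis of a chosen (possibly randomly chosen) Pauli matrix $P_i\in\{\sigma_X,\sigma_Y,\sigma_Z\}$. The outcome $(s_1,\dots,s_n)\in\{+1,-1\}^n$ occurs with probability $\operatorname{tr}\big(\rho\bigotimes_{i=1}^n \tfrac{I+s_iP_i}{2}\big)$. The output is computed classically from the chosen bases and the outcomes.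
   Formalization: Taken with δ<1 throughout; the lower bound in (1) is for ε≤1/2 and δ≤1/2; the upper bound in (1) assumes n>1 or δ≤1/2, and (2) assumes k<n or δ≤1/2, since the claims fail for large ε or when the logarithm tends to 0 as δ→1. *)

(* Defs.v *)
From HB Require Import structures.
From mathcomp Require Import all_boot all_order all_algebra.
From mathcomp Require Import complex.
From mathcomp Require Import all_classical all_reals all_analysis.

Set Implicit Arguments.
Unset Strict Implicit.
Unset Printing Implicit Defensive.

Import Order.TTheory GRing.Theory Num.Theory.
Local Open Scope ring_scope.
Local Open Scope sesquilinear_scope.

(** The qubits of a system are labelled by a finite type [Q]; the computational
    basis of its Hilbert space is [bits Q], with [false], [true] standing for
    |0>, |1>.  Matrices are indexed by the canonical enumeration of [bits Q], so
    that the library's matrix theory applies to them. *)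

Definition bits (Q : finType) : finType := {ffun Q -> bool}.

Notation op R Q := 'M[R[i]]_(#|bits Q|).

Definition entry (R : realType) (Q : finType) (A : op R Q) (u v : bits Q) : R[i] :=
  A (enum_rank u) (enum_rank v).

Definition mkop (R : realType) (Q : finType) (f : bits Q -> bits Q -> R[i]) :
  op R Q := \matrix_(a, b) f (enum_val a) (enum_val b).

Definition quad (R : realType) (N : nat) (A : 'M[R[i]]_N) (v : 'cV[R[i]]_N) : R[i] :=
  (v ^t* *m A *m v) 0 0.

Definition psd (R : realType) (N : nat) (A : 'M[R[i]]_N) : Prop :=
  A \is hermsymmx /\ forall v : 'cV[R[i]]_N, 0 <= quad A v.

Record density (R : realType) (Q : finType) := Density {
  density_op :> op R Q;
  density_psd : psd density_op;
  density_tr : \tr density_op = 1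
}.

Definition subsystem (Q : finType) (S : {set Q}) : finType := {q : Q | q \in S}.

Definition restrict (Q : finType) (S : {set Q}) (u : bits Q) : bits (subsystem S) :=
  [ffun q => u (val q)].

(** The reduced operator on [S]: sum over the pairs of basis vectors that extend
    [x] and [y] and agree on the qubits outside [S]. *)
Definition reduced (R : realType) (Q : finType) (S : {set Q}) (A : op R Q) :
  op R (subsystem S) :=
  mkop (fun x y =>
    \sum_(u | restrict S u == x)
      \sum_(v | (restrict S v == y) && (restrict (~: S) u == restrict (~: S) v))
        entry A u v).

(** Square root by functional calculus: [B = U^-1 *m diag_mx d *m U] whenever
    [B] is normal, where [U = spectralmx B] is unitary and [d = spectral_diag B]. *)
Definition sqrtmx (R : realType) (N : nat) (B : 'M[R[i]]_N) : 'M[R[i]]_N :=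
  invmx (spectralmx B) *m diag_mx (map_mx sqrtC (spectral_diag B)) *m spectralmx B.

(** The trace is real, being that of a positive semidefinite matrix. *)
Definition trace_norm (R : realType) (N : nat) (A : 'M[R[i]]_N) : R :=
  complex.Re (\tr (sqrtmx (A ^t* *m A))).

Definition born (R : realType) (N : nat) (A E : 'M[R[i]]_N) : R :=
  complex.Re (\tr (A *m E)).

(** A task asks for one density matrix for each index [i : I], approximating the
    reduced state on the set [F i] of qubits. *)

Definition accurate (R : realType) (n : nat) (I : finType) (F : I -> {set 'I_n})
    (eps : R) (rho : density R 'I_n)
    (sigma : forall i : I, density R (subsystem (F i))) : bool :=
  [forall i, trace_norm (reduced (F i) rho - density_op (sigma i)) < eps].

(** Overlapping tomography is the task indexed by all sets of at most [k] qubits. *)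
Definition small_set (n k : nat) : finType := {S : {set 'I_n} | (#|S| <= k)%N}.

Definition small_set_val (n k : nat) (S : small_set n k) : {set 'I_n} := val S.

(** [m] copies of a system [Q] form the system ['I_m * Q]. *)

Definition copy_of (T : Type) (m : nat) (Q : finType) (u : {ffun 'I_m * Q -> T})
    (c : 'I_m) : {ffun Q -> T} := [ffun q => u (c, q)].

Definition tensor_power (R : realType) (m : nat) (Q : finType) (A : op R Q) :
  op R ('I_m * Q)%type :=
  mkop (fun u v => \prod_(c < m) entry A (copy_of u c) (copy_of v c)).

(** Positive operator-valued measures on an arbitrary measurable space of
    outcomes, with weak countable additivity. *)
Record povm (R : realType) (d : measure_display) (T : measurableType d) (N : nat) :=
  POVM {
    effect :> set T -> 'M[R[i]]_N;
    effect_psd : forall A : set T, measurable A -> psd (effect A);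
    effect_setT : effect setT = 1%:M;
    effect_additive : forall v : 'cV[R[i]]_N,
      semi_sigma_additive (fun A : set T => (complex.Re (quad (effect A) v))%:E)
  }.

(** The estimator [est] maps the outcome to the list of output density matrices.
    Success with probability at least [1 - delta] means that some measurable
    event of at least this probability consists of successful outcomes; when the
    set of successful outcomes is measurable, this says that its own probability
    is at least [1 - delta]. *)
Definition joint_achieves (R : realType) (n : nat) (I : finType)
    (F : I -> {set 'I_n}) (eps delta : R) (m : nat) : Prop :=
  exists (d : measure_display) (T : measurableType d)
         (E : povm R T #|bits ('I_m * 'I_n)%type|)
         (est : T -> forall i : I, density R (subsystem (F i))),
  forall rho : density R 'I_n,
  exists A : set T,
    [/\ measurable A,
        forall y, A y -> accurate eps rho (est y) &
        1 - delta <= born (tensor_power m (density_op rho)) (E A)].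

Inductive pauli := PX | PY | PZ.

Definition ord_of_pauli (P : pauli) : 'I_3 :=
  match P with PX => inord 0 | PY => inord 1 | PZ => inord 2 end.

Definition pauli_of_ord (i : 'I_3) : pauli :=
  match nat_of_ord i with 0%N => PX | 1%N => PY | _ => PZ end.

Lemma ord_of_pauliK : cancel ord_of_pauli pauli_of_ord.
Proof. by case; rewrite /pauli_of_ord /= inordK. Qed.

HB.instance Definition _ := Finite.copy pauli (can_type ord_of_pauliK).

Definition pauli_entry (R : realType) (P : pauli) (a b : bool) : R[i] :=
  match P with
  | PX => (a != b)%:R
  | PY => if a == b then 0 else if a then Complex 0 1 else Complex 0 (- 1)
  | PZ => if a == b then (-1) ^+ a else 0
  end.

(** The tensor product over the qubits [q] of the projections (I + s_q P_q) / 2.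
    An outcome bit [b] stands for the outcome [(-1) ^+ b]. *)
Definition pauli_projection (R : realType) (Q : finType) (P : {ffun Q -> pauli})
    (s : bits Q) : op R Q :=
  mkop (fun u v =>
    \prod_(q : Q) (((u q == v q)%:R
                    + (-1) ^+ (s q) * pauli_entry R (P q) (u q) (v q)) / 2%:R)).

(** [pauli_prob rho P s] is the probability of the outcomes [s] when, in each copy
    [c] of [rho], each qubit [q] is measured in the basis [P (c, q)]. *)
Definition pauli_prob (R : realType) (n m : nat) (rho : density R 'I_n)
    (P : {ffun 'I_m * 'I_n -> pauli}) (s : bits ('I_m * 'I_n)%type) : R :=
  \prod_(c < m) born rho (pauli_projection R (copy_of P c) (copy_of s c)).

(** The bases for all copies are drawn from a distribution [mu] fixed in advance,
    and the output is a function of the bases and the outcomes. *)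
Definition pauli_achieves (R : realType) (n : nat) (I : finType)
    (F : I -> {set 'I_n}) (eps delta : R) (m : nat) : Prop :=
  exists (mu : {ffun 'I_m * 'I_n -> pauli} -> R)
         (est : {ffun 'I_m * 'I_n -> pauli} -> bits ('I_m * 'I_n)%type ->
                forall i : I, density R (subsystem (F i))),
  [/\ forall P, 0 <= mu P,
      \sum_P mu P = 1 &
      forall rho : density R 'I_n,
        1 - delta <=
        \sum_P mu P * \sum_(s | accurate eps rho (est P s)) pauli_prob rho P s].

Definition sample_complexity (achieves : nat -> Prop) (N : nat) : Prop :=
  achieves N /\ forall m, achieves m -> (N <= m)%N.

(* Main.v *)
(** Upper bounds.  In Pauli coordinates [pauli_exp rho f = tr (rho f)], the squared
    trace norm of the difference of two reduced states on [S] is at most the sum of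
    the squared differences of the coordinates supported in [S].  This sum is
    monotone in [S], so only sets of exactly [k] qubits matter.  A single copy
    measured in uniformly random Pauli bases gives an unbiased estimate of all the
    coordinates, whose second moments sum to [10 ^+ k] on [k] qubits.  Batches of
    [O(10 ^+ k / eps ^+ 2)] copies are then accurate with probability [15 / 16],
    and the output is any global state that agrees, on each set, with most of
    [O(ln (M / delta))] batches: the true state is such a state, and two such states
    share a good batch.

    Lower bound.  On diagonal product states, a joint measurement is a randomized
    function of [m] classical samples of [n] independent coins.  If the biases of the
    coins are separated by [2 * eps], the events of accuracy for distinct bias
    vectors are disjoint, hence a strategy is no better than maximum likelihood,
    whose success probability factorizes over the qubits. *)

From mathcomp Require Import all_boot all_order all_algebra.
From mathcomp Require Import complex.
From mathcomp Require Import all_classical all_reals all_analysis.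
From mathcomp Require Import ring lra zify.
Require Import Defs.

Set Implicit Arguments.
Unset Strict Implicit.
Unset Printing Implicit Defensive.

Import Order.TTheory GRing.Theory Num.Theory.
Local Open Scope ring_scope.
Local Open Scope sesquilinear_scope.

(** * Trace norm *)

Lemma Re_sum (R : realType) (I : Type) (r : seq I) (P : pred I) (F : I -> R[i]) :
  complex.Re (\sum_(i <- r | P i) F i) = \sum_(i <- r | P i) complex.Re (F i).
Proof. by apply: (big_morph (@complex.Re R)) => // -[a b] [c d]. Qed.

Lemma ReN (R : realType) (z : R[i]) : complex.Re (- z) = - complex.Re z.
Proof. by case: z. Qed.

Lemma ReB (R : realType) (y z : R[i]) :
  complex.Re (y - z) = complex.Re y - complex.Re z.
Proof. by case: y z => [a b] []. Qed.

Lemma ReZ (R : realType) (a : R) (z : R[i]) :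
  complex.Re (a%:C%C * z) = a * complex.Re z.
Proof. by case: z => b c /=; rewrite mul0r subr0. Qed.

Lemma Re_ge0 (R : realType) (z : R[i]) : 0 <= z -> 0 <= complex.Re z.
Proof. by case: z => a b; rewrite lecE /= => /andP[]. Qed.

Lemma ge0_ReK (R : realType) (z : R[i]) : 0 <= z -> (complex.Re z)%:C%C = z.
Proof. by move=> z0; rewrite RRe_real ?ger0_real. Qed.

Lemma Re_norm2 (R : realType) (z : R[i]) :
  complex.Re (z * z^*) = complex.Re z ^+ 2 + complex.Im z ^+ 2.
Proof. by case: z => a b /=; rewrite !expr2 mulrN opprK. Qed.

(** Cauchy-Schwarz against the constant vector: the gap is half the sum of all
    [(x i - x j) ^+ 2]. *)
Lemma sqr_sum_le (R : realType) (I : finType) (x : I -> R) :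
  (\sum_i x i) ^+ 2 <= #|I|%:R * \sum_i x i ^+ 2.
Proof.
have h : 0 <= \sum_i \sum_j (x i - x j) ^+ 2.
  by apply: sumr_ge0 => i _; apply: sumr_ge0 => j _; exact: sqr_ge0.
have inner i : \sum_j (x i - x j) ^+ 2 =
    #|I|%:R * x i ^+ 2 - 2 * x i * \sum_j x j + \sum_j x j ^+ 2.
  rewrite mulr_sumr mulr_natl -sumr_const -sumrB -big_split /=.
  by apply: eq_bigr => j _; ring.
have e : \sum_i \sum_j (x i - x j) ^+ 2 =
    2 * (#|I|%:R * \sum_i x i ^+ 2 - (\sum_i x i) ^+ 2).
  under eq_bigr do rewrite inner.
  rewrite big_split sumrB /= sumr_const -mulr_sumr -mulr_suml -mulr_sumr.
  by rewrite -[X in _ + X]mulr_natl; ring.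
by rewrite e in h; lra.
Qed.

(* [x i] is the square root of the [i]-th eigenvalue of [A^t* *m A]. *)
Lemma trace_norm_spectral (R : realType) (N : nat) (A : 'M[R[i]]_N) :
  exists (V : 'M[R[i]]_N) (x : 'I_N -> R),
    [/\ V \is unitarymx, forall i, 0 <= x i, trace_norm A = \sum_i x i &
        forall i, (x i ^+ 2)%:C%C = \sum_j (A *m V ^t*) j i * ((A *m V ^t*) j i)^*].
Proof.
pose H := A ^t* *m A; pose V := spectralmx H; pose e := spectral_diag H.
have VU : V \is unitarymx by exact: spectral_unitarymx.
have Hherm : H \is hermsymmx.
  rewrite qualifE /= expr0 scale1r /H trmx_mul map_mxM.
  by rewrite trmxCK.
have HE : H = invmx V *m diag_mx e *m V.
  by apply/orthomx_spectralP; exact: hermitian_normalmx.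
have eE i : e 0 i = \sum_j (A *m V ^t*) j i * ((A *m V ^t*) j i)^*.
  have : V *m H *m V ^t* = diag_mx e.
    rewrite HE -(invmx_unitary VU) !mulmxA mulmxV ?mul1mx ?mulmxK //;
    exact: unitarymx_unit.
  move/matrixP/(_ i i); rewrite !mxE eqxx mulr1n => <-.
  have -> : \sum_j (V *m H) i j * (V ^t*) j i = (V *m H *m V ^t*) i i.
    by rewrite [RHS]mxE.
  have -> : V *m H *m V ^t* = (A *m V ^t*) ^t* *m (A *m V ^t*).
    by rewrite trmx_mul map_mxM trmxCK /H !mulmxA.
  by rewrite mxE; apply: eq_bigr => j _; rewrite !mxE mulrC.
have e0 i : 0 <= e 0 i.
  by rewrite eE; apply: sumr_ge0 => j _; exact: mul_conjC_ge0.
exists V, (fun i => complex.Re (sqrtC (e 0 i))); split => //.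
- by move=> i; apply: Re_ge0; rewrite sqrtC_ge0.
- rewrite /trace_norm /sqrtmx mxtrace_mulC mulmxA mulmxV ?mul1mx; last first.
    exact: unitarymx_unit.
  rewrite mxtrace_diag Re_sum; apply: eq_bigr => i _.
  by rewrite mxE.
- by move=> i; rewrite -eE rmorphXn /= ge0_ReK ?sqrtC_ge0 // sqrtCK.
Qed.

Lemma trace_norm_ge0 (R : realType) (N : nat) (A : 'M[R[i]]_N) :
  0 <= trace_norm A.
Proof.
by have [V [x [_ x0 -> _]]] := trace_norm_spectral A; exact: sumr_ge0.
Qed.

(** Cauchy-Schwarz for the [N] singular values, whose squares sum to the squared Hilbert-Schmidt
    norm. *)
Lemma trace_norm_sqr_le (R : realType) (N : nat) (A : 'M[R[i]]_N) :
  trace_norm A ^+ 2 <= N%:R * complex.Re (\tr (A ^t* *m A)).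
Proof.
have [V [x [VU x0 -> xE]]] := trace_norm_spectral A.
have -> : complex.Re (\tr (A ^t* *m A)) = \sum_i x i ^+ 2.
  have -> : \tr (A ^t* *m A) = \tr ((A *m V ^t*) ^t* *m (A *m V ^t*)).
    rewrite trmx_mul map_mxM trmxCK !mulmxA [RHS]mxtrace_mulC !mulmxA.
    rewrite -(invmx_unitary VU) mulVmx ?mul1mx //; exact: unitarymx_unit.
  rewrite /mxtrace Re_sum; apply: eq_bigr => i _.
  transitivity (complex.Re (x i ^+ 2)%:C%C) => //.
  by rewrite xE mxE; congr complex.Re; apply: eq_bigr => j _; rewrite !mxE mulrC.
by apply: le_trans (sqr_sum_le x) _; rewrite card_ord.
Qed.

(** Cauchy-Schwarz, by expanding the squared norm of [x f - g^*]. The case [x = 0] is treated apart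
    because the last step cancels a factor [x]. *)
Lemma Re_sum_mul_le (R : realType) (I : finType) (f g : I -> R[i]) (x : R) :
  0 <= x -> \sum_i f i * (f i)^* = 1 -> \sum_i g i * (g i)^* = (x ^+ 2)%:C%C ->
  complex.Re (\sum_i f i * g i) <= x.
Proof.
move=> x0 /(congr1 (@complex.Re R)) f1 /(congr1 (@complex.Re R)) gx.
move: f1 gx; rewrite /= !Re_sum => f1 gx.
move: f1 gx; under eq_bigr do rewrite Re_norm2; move=> f1.
under eq_bigr do rewrite Re_norm2; move=> gx.
have [x1|x1] := eqVneq x 0.
  rewrite x1 expr0n /= in gx.
  rewrite x1 big1 // => i _.
  have /eqP : complex.Re (g i) ^+ 2 + complex.Im (g i) ^+ 2 = 0.
    by apply: (psumr_eq0P _ gx) => // j _; rewrite addr_ge0 ?sqr_ge0.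
  rewrite paddr_eq0 ?sqr_ge0 // !sqrf_eq0 => /andP[/eqP a /eqP b].
  by case: (f i) (g i) a b => [? ?] [? ?] /= -> ->; rewrite !mulr0 subr0.
have {}x0 : 0 < x by rewrite lt_def x1.
have : 0 <= \sum_i ((x * complex.Re (f i) - complex.Re (g i)) ^+ 2
                  + (x * complex.Im (f i) + complex.Im (g i)) ^+ 2).
  by apply: sumr_ge0 => i _; rewrite addr_ge0 ?sqr_ge0.
have -> : \sum_i ((x * complex.Re (f i) - complex.Re (g i)) ^+ 2
                  + (x * complex.Im (f i) + complex.Im (g i)) ^+ 2) =
   x ^+ 2 * \sum_i (complex.Re (f i) ^+ 2 + complex.Im (f i) ^+ 2) +
   \sum_i (complex.Re (g i) ^+ 2 + complex.Im (g i) ^+ 2)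
   - 2 * x * \sum_i complex.Re (f i * g i).
  rewrite !mulr_sumr -big_split -sumrB /=; apply: eq_bigr => i _.
  by case: (f i) (g i) => [a b] [c d] /=; ring.
rewrite f1 gx mulr1 => h.
by rewrite -(ler_pM2l x0); lra.
Qed.

(** In the eigenbasis [V] of [A^t* *m A], the [i]-th diagonal term pairs a unit row of [V *m Z] with
    a column of [A *m V ^t*] whose norm is the [i]-th singular value. *)
Lemma Re_tr_unitary_le (R : realType) (N : nat) (A Z : 'M[R[i]]_N) :
  Z \is unitarymx -> complex.Re (\tr (A *m Z)) <= trace_norm A.
Proof.
move=> ZU; have [V [x [VU x0 -> xE]]] := trace_norm_spectral A.
have -> : \tr (A *m Z) = \tr ((V *m Z) *m (A *m V ^t*)).
  rewrite [RHS]mxtrace_mulC !mulmxA -(invmx_unitary VU) mulmxKV //.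
  exact: unitarymx_unit.
rewrite /mxtrace Re_sum; apply: ler_sum => i _; rewrite mxE.
apply: Re_sum_mul_le => //.
have /unitarymxP/matrixP/(_ i i) := mul_unitarymx VU ZU.
rewrite [RHS]mxE eqxx /= => VZ; rewrite -[RHS]VZ [RHS]mxE.
by apply: eq_bigr => j _; rewrite !mxE.
Qed.

(** * Reduced states and Pauli coordinates *)

Section Entries.
Variables (R : realType) (Q : finType).
Implicit Types A B : op R Q.

Lemma sum_bits (V : nmodType) (F : 'I_#|bits Q| -> V) :
  \sum_a F a = \sum_(u : bits Q) F (enum_rank u).
Proof.
rewrite (reindex (@enum_rank (bits Q))) //.
by exists enum_val => x _; rewrite ?enum_rankK ?enum_valK.
Qed.

Lemma entry_mkop (f : bits Q -> bits Q -> R[i]) u v : entry (mkop f) u v = f u v.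
Proof. by rewrite /entry mxE !enum_rankK. Qed.

Lemma entryP A B : (forall u v, entry A u v = entry B u v) -> A = B.
Proof.
move=> AB; apply/matrixP => a b.
by have := AB (enum_val a) (enum_val b); rewrite /entry !enum_valK.
Qed.

Lemma entryM A B u v : entry (A *m B) u v = \sum_w entry A u w * entry B w v.
Proof. by rewrite /entry mxE sum_bits. Qed.

Lemma entry_adj A u v : entry (A ^t*) u v = (entry A v u)^*.
Proof. by rewrite /entry !mxE. Qed.

Lemma entry1 u v : entry (1%:M : op R Q) u v = (u == v)%:R.
Proof. by rewrite /entry mxE (inj_eq enum_rank_inj). Qed.

Lemma entryB A B u v : entry (A - B) u v = entry A u v - entry B u v.
Proof. by rewrite /entry !mxE. Qed.

Lemma tr_entry A : \tr A = \sum_u entry A u u.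
Proof. by rewrite /mxtrace sum_bits. Qed.

Lemma trM_entry A B : \tr (A *m B) = \sum_u \sum_v entry A u v * entry B v u.
Proof. by rewrite tr_entry; apply: eq_bigr => u _; rewrite entryM. Qed.

Lemma quad_entry A (w : 'cV[R[i]]_#|bits Q|) :
  quad A w = \sum_u \sum_v (w (enum_rank u) 0)^* * entry A u v * w (enum_rank v) 0.
Proof.
rewrite /quad mxE sum_bits exchange_big; apply: eq_bigr => u _ /=.
rewrite mxE sum_bits mulr_suml; apply: eq_bigr => v _.
by rewrite !mxE.
Qed.

Lemma psdP A :
  psd A <-> (forall u v, entry A u v = (entry A v u)^*) /\
    forall w : bits Q -> R[i], 0 <= \sum_u \sum_v (w u)^* * entry A u v * w v.
Proof.
split=> [[Ah Aq]|[Ah Aq]].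
  split=> [u v|w].
    have /is_hermitianmxP := Ah; rewrite expr0 scale1r => {1}->.
    by rewrite entry_adj.
  have := Aq (\col_a w (enum_val a)); rewrite quad_entry.
  by under eq_bigr do under eq_bigr do rewrite !mxE !enum_rankK.
split=> [|w]; last by rewrite quad_entry; exact: Aq.
apply/is_hermitianmxP; rewrite expr0 scale1r.
by apply: entryP => u v; rewrite entry_adj.
Qed.

End Entries.

Section Reduction.
Variables (R : realType) (Q : finType).
Implicit Types (A B : op R Q) (S : {set Q}) (u v : bits Q).

Definition agree_off S u v : bool := restrict (~: S) u == restrict (~: S) v.

Lemma restrict_eqE S u v :
  (restrict S u == restrict S v) = [forall q in S, u q == v q].
Proof.
apply/eqP/forall_inP => [uv q qS|uv].
  by have /ffunP/(_ (exist _ q qS)) := uv; rewrite !ffunE /= => ->.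
by apply/ffunP => -[q qS]; rewrite !ffunE; apply/eqP/uv.
Qed.

Lemma restrict_inj S u v :
  restrict S u = restrict S v -> agree_off S u v -> u = v.
Proof.
move=> /eqP; rewrite /agree_off !restrict_eqE => /forall_inP h1 /forall_inP h2.
apply/ffunP => q; apply/eqP; have [|qS] := boolP (q \in S); first exact: h1.
by apply: h2; rewrite inE.
Qed.

(** The partial trace is adjoint to tensoring with the identity outside [S]. *)
Lemma reduced_pairing S A (g : bits (subsystem S) -> bits (subsystem S) -> R[i]) :
  \sum_x \sum_y entry (reduced S A) x y * g x y =
  \sum_u \sum_(v | agree_off S u v) entry A u v * g (restrict S u) (restrict S v).
Proof.
rewrite [RHS](partition_big (restrict S) predT) //=; apply: eq_bigr => x _.
under eq_bigr do rewrite entry_mkop mulr_suml.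
rewrite exchange_big; apply: eq_bigr => u /eqP <- /=.
rewrite [RHS](partition_big (restrict S) predT) //=; apply: eq_bigr => y _.
rewrite mulr_suml; apply: eq_big => [v|v /andP[/eqP -> _]] //.
by rewrite andbC.
Qed.

Lemma reducedB S A B : reduced S (A - B) = reduced S A - reduced S B.
Proof.
apply: entryP => x y; rewrite entryB !entry_mkop -sumrB; apply: eq_bigr => u _.
by rewrite -sumrB; apply: eq_bigr => v _; rewrite entryB.
Qed.

(** For a diagonal observable only [u = v] survives, as basis vectors that agree on [S] and off [S]
    are equal. *)
Lemma tr_reducedM S A (g : bits (subsystem S) -> R[i]) :
  \sum_x entry (reduced S A) x x * g x = \sum_u entry A u u * g (restrict S u).
Proof.
transitivity (\sum_x \sum_y entry (reduced S A) x y * (if x == y then g x else 0)).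
  apply: eq_bigr => x _; rewrite (bigD1 x) //= eqxx big1 ?addr0 // => y.
  by rewrite eq_sym => /negPf ->; rewrite mulr0.
rewrite reduced_pairing; apply: eq_bigr => u _.
rewrite (bigD1 u) /=; last by rewrite /agree_off.
rewrite eqxx big1 ?addr0 // => v /andP[uv vu].
case: eqP => [e|_]; last by rewrite mulr0.
by rewrite (restrict_inj e uv) eqxx in vu.
Qed.

Lemma reduced_psd S A : psd A -> psd (reduced S A).
Proof.
move=> /psdP[Ah Aq]; apply/psdP; split.
  move=> x y; rewrite !entry_mkop rmorph_sum /=.
  under [RHS]eq_bigr do rewrite rmorph_sum.
  rewrite (exchange_big_dep (fun v => restrict S v == y)) /=; last first.
    by move=> u v _ /andP[].
  apply: eq_bigr => v /eqP vy; apply: eq_big => [u|u _]; last exact: Ah.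
  by rewrite vy eqxx /= [X in _ && X]eq_sym.
move=> w.
rewrite (eq_bigr (fun x => \sum_y entry (reduced S A) x y * ((w x)^* * w y))); last first.
  by move=> x _; apply: eq_bigr => y _; ring.
rewrite reduced_pairing.
(* Each basis vector [z] of the traced-out qubits contributes the quadratic form of [A] at the
   vector [w] placed on the slice where those qubits read [z]. *)
rewrite (partition_big (restrict (~: S)) predT) //=; apply: sumr_ge0 => z _.
have := Aq (fun u => (restrict (~: S) u == z)%:R * w (restrict S u)).
congr (0 <= _); rewrite [RHS]big_mkcond; apply: eq_bigr => u _.
have [uz|uz] := eqVneq; last first.
  by rewrite big1 // => v _; rewrite mul0r rmorph0 !mul0r.
rewrite [RHS]big_mkcond; apply: eq_bigr => v _.
rewrite /agree_off uz [z == _]eq_sym; case: eqP => _ /=.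
  by rewrite !mul1r; ring.
by rewrite mul0r mulr0.
Qed.

Lemma reduced_tr S A : \tr (reduced S A) = \tr A.
Proof.
rewrite !tr_entry; have := tr_reducedM A (fun _ : bits (subsystem S) => 1).
by under eq_bigr do rewrite mulr1; under [in X in _ = X -> _]eq_bigr do rewrite mulr1.
Qed.

Definition reduced_density S (rho : density R Q) : density R (subsystem S) :=
  Density (reduced_psd S (density_psd rho))
          (etrans (reduced_tr S rho) (density_tr rho)).

End Reduction.

(** * Pauli strings and Parseval's identity *)

Section PauliStrings.
Variables (R : realType) (Q : finType).
Implicit Types (X Y : op R Q) (S : {set Q}) (u v : bits Q).

(** [None] stands for the identity. *)
Definition opauli_entry (o : option pauli) (a b : bool) : R[i] :=
  if o is Some p then pauli_entry R p a b else (a == b)%:R.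

(** Strings keep the type of the whole system, so that those on a subset of [S] are literally among
    those on [S]. *)
Definition pauli_strings S : {pred {ffun Q -> option pauli}} :=
  family (fun q => [pred o | (q \in S) || (o == None)]).

(** The trace of [X] times the tensor product of the [f q], which is why the factors have their
    indices swapped. *)
Definition pauli_coef X (f : {ffun Q -> option pauli}) : R[i] :=
  \sum_u \sum_v entry X u v * \prod_q opauli_entry (f q) (v q) (u q).

Lemma big_pauli (V : nmodType) (F : pauli -> V) :
  \sum_p F p = F PX + F PY + F PZ.
Proof.
rewrite (bigD1 PX) //= (bigD1 PY) /=; last by apply/eqP.
rewrite (bigD1 PZ) /=; last by apply/andP; split; apply/eqP.
rewrite big1; first by rewrite addr0 addrA.
by case; rewrite !eqxx ?andbF.
Qed.

Lemma big_option (V : nmodType) (T : finType) (F : option T -> V) :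
  \sum_o F o = F None + \sum_p F (Some p).
Proof.
rewrite (bigD1 None) //=; congr (_ + _).
rewrite (reindex_omap (@Some T) id) //=; last by case.
by apply: eq_bigl => p; rewrite eqxx.
Qed.

Lemma opauli_herm o a b : (opauli_entry o b a)^* = opauli_entry o a b.
Proof.
by case: o a b => [[]|] [] [] //=; rewrite ?rmorphN ?rmorphXn ?rmorph1 ?rmorph0 //=;
  apply/eqP; rewrite eq_complex /= ?opprK ?oppr0 !eqxx.
Qed.

(** The identity and the three Pauli matrices form an orthogonal basis of the 2 by 2 matrices, each
    of squared norm 2. *)
Lemma opauli_complete a b c d :
  \sum_o opauli_entry o b a * (opauli_entry o d c)^* =
  2 * ((a == c) && (b == d))%:R.
Proof.
rewrite big_option big_pauli.
by case: a b c d => [] [] [] [] /=; apply/eqP; rewrite eq_complex /=;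
  apply/andP; split; apply/eqP; rewrite ?expr0 ?expr1 /=; ring.
Qed.

(** The sum factorizes over the qubits: one in [S] contributes the completeness relation, one
    outside only its identity factor. *)
Lemma pauli_strings_complete S u v u' v' :
  \sum_(f in pauli_strings S)
    (\prod_q opauli_entry (f q) (v q) (u q)) *
    (\prod_q opauli_entry (f q) (v' q) (u' q))^* =
  2 ^+ #|S| * [&& restrict S u == restrict S u', restrict S v == restrict S v',
                 agree_off S u v & agree_off S u' v']%:R.
Proof.
under eq_bigr do rewrite rmorph_prod -big_split /=.
rewrite -(bigA_distr_big_dep (fun q o => (q \in S) || (o == None))
  (fun q o => opauli_entry o (v q) (u q) * (opauli_entry o (v' q) (u' q))^*)) /=.
rewrite (bigID (mem S)) /=.
have -> : \prod_(q in S) \sum_(o | (q \in S) || (o == None))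
     opauli_entry o (v q) (u q) * (opauli_entry o (v' q) (u' q))^* =
   2 ^+ #|S| * (restrict S u == restrict S u')%:R * (restrict S v == restrict S v')%:R.
  under eq_bigr => q qS.
    under eq_bigl do rewrite qS.
    rewrite opauli_complete; over.
  rewrite big_split prodr_const /= -mulrA -natrM mulnb !restrict_eqE; congr (_ * _).
  case: (altP andP) => [[/forall_inP uu /forall_inP vv]|].
    by rewrite big1 // => q qS; rewrite uu ?vv.
  move=> h; apply/eqP; rewrite prodf_seq_eq0; apply/hasP.
  have : ~~ [forall q in S, (u q == u' q) && (v q == v' q)].
    apply: contra h => /forall_inP h.
    by apply/andP; split; apply/forall_inP => q /h /andP[].
  rewrite negb_forall => /existsP[q]; rewrite negb_imply => /andP[qS /negPf qn].
  by exists q; rewrite ?mem_index_enum // qS qn /=.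
have -> : \prod_(q | q \notin S) \sum_(o | (q \in S) || (o == None))
     opauli_entry o (v q) (u q) * (opauli_entry o (v' q) (u' q))^* =
   (agree_off S u v)%:R * (agree_off S u' v')%:R.
  under eq_bigr => q qS.
    rewrite (negPf qS) big_pred1_eq /= conjC_nat -natrM mulnb; over.
  rewrite -natrM mulnb /agree_off !restrict_eqE.
  case: (altP andP) => [[/forall_inP uu /forall_inP vv]|].
    rewrite big1 // => q qS; have qC : q \in ~: S by rewrite inE.
    by rewrite [v q == _]eq_sym [v' q == _]eq_sym uu ?vv.
  move=> h; apply/eqP; rewrite prodf_seq_eq0; apply/hasP.
  have : ~~ [forall q in ~: S, (v q == u q) && (v' q == u' q)].
    apply: contra h => /forall_inP h.
    by apply/andP; split; apply/forall_inP => q /h /andP[/eqP e1 /eqP e2];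
      rewrite ?e1 ?e2.
  rewrite negb_forall => /existsP[q]; rewrite negb_imply inE => /andP[qS /negPf qn].
  by exists q; rewrite ?mem_index_enum // qS qn /=.
by rewrite -!mulrA -!natrM !mulnb.
Qed.

(** Expanding both coefficients leaves the completeness relation, whose conditions on [u], [v],
    [u'], [v'] are those of a product of two entries of the reduced operator. *)
Lemma pauli_parseval X S :
  \sum_(f in pauli_strings S) pauli_coef X f * (pauli_coef X f)^* =
  2 ^+ #|S| * \tr ((reduced S X) ^t* *m reduced S X).
Proof.
transitivity (\sum_u \sum_v \sum_u' \sum_v' entry X u v * (entry X u' v')^* *
  (2 ^+ #|S| * [&& restrict S u == restrict S u', restrict S v == restrict S v',
                 agree_off S u v & agree_off S u' v']%:R)).
  under eq_bigr do rewrite mulr_suml.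
  rewrite exchange_big; apply: eq_bigr => u _ /=.
  under eq_bigr do rewrite mulr_suml.
  rewrite exchange_big; apply: eq_bigr => v _ /=.
  under eq_bigr do rewrite rmorph_sum mulr_sumr.
  rewrite exchange_big; apply: eq_bigr => u' _ /=.
  under eq_bigr do rewrite rmorph_sum mulr_sumr.
  rewrite exchange_big; apply: eq_bigr => v' _ /=.
  rewrite -pauli_strings_complete mulr_sumr; apply: eq_bigr => f _.
  by rewrite rmorphM /= mulrACA.
rewrite trM_entry [in RHS]exchange_big /=.
under [in RHS]eq_bigr do under eq_bigr do rewrite entry_adj mulrC.
have /= -> := reduced_pairing X (fun x y => (entry (reduced S X) x y)^*).
rewrite mulr_sumr.
apply: eq_bigr => u _; rewrite mulr_sumr [RHS]big_mkcond; apply: eq_bigr => v _ /=.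
rewrite entry_mkop; case: (agree_off S u v); last first.
  by rewrite big1 // => u' _; rewrite big1 // => v' _; rewrite !andbF !mulr0.
rewrite rmorph_sum !mulr_sumr [RHS]big_mkcond; apply: eq_bigr => u' _ /=.
rewrite eq_sym; case: eqP => _ /=; last first.
  by rewrite big1 // => v' _; rewrite !mulr0.
rewrite rmorph_sum !mulr_sumr [RHS]big_mkcond; apply: eq_bigr => v' _ /=.
rewrite [_ == restrict S v']eq_sym /agree_off; case: (_ && _); last by rewrite !mulr0.
by rewrite mulr1 mulrC.
Qed.

Definition pauli_dist2 S (x y : {ffun Q -> option pauli} -> R) : R :=
  \sum_(f in pauli_strings S) (x f - y f) ^+ 2.

Definition pauli_exp X (f : {ffun Q -> option pauli}) : R :=
  complex.Re (pauli_coef X f).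

Lemma pauli_coefB X Y f : pauli_coef (X - Y) f = pauli_coef X f - pauli_coef Y f.
Proof.
rewrite /pauli_coef -sumrB; apply: eq_bigr => u _.
by rewrite -sumrB; apply: eq_bigr => v _; rewrite entryB mulrBl.
Qed.

Lemma pauli_coef_real (rho : density R Q) f : (pauli_exp rho f)%:C%C = pauli_coef rho f.
Proof.
rewrite /pauli_exp RRe_real //; apply/CrealP.
rewrite /pauli_coef rmorph_sum; under eq_bigr do rewrite rmorph_sum.
rewrite exchange_big /=; apply: eq_bigr => u _.
have /psdP[rho_h _] := density_psd rho.
apply: eq_bigr => v _; rewrite rmorphM rmorph_prod /= -rho_h; congr (_ * _).
by apply: eq_bigr => q _; rewrite opauli_herm.
Qed.

Lemma pauli_dist2_mono S S' x y : S \subset S' ->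
  pauli_dist2 S x y <= pauli_dist2 S' x y.
Proof.
move=> /fintype.subsetP SS'; rewrite /pauli_dist2 [leRHS]big_mkcond [leLHS]big_mkcond /=.
apply: ler_sum => f _; have [/familyP fS|] := boolP (f \in pauli_strings S).
  rewrite ifT //; apply/familyP => q; move: (fS q); rewrite !inE.
  by case/orP => [/SS' -> //|->]; rewrite orbT.
by move=> _; case: ifP => // _; exact: sqr_ge0.
Qed.

(** The dimension factor lost in passing to the Hilbert-Schmidt norm is exactly the [2 ^+ #|S|] of
    Parseval's identity, so no constant remains. *)
Lemma trace_norm_pauli S (rho tau : density R Q) :
  trace_norm (reduced S rho - reduced S tau) ^+ 2 <=
  pauli_dist2 S (pauli_exp rho) (pauli_exp tau).
Proof.
rewrite -reducedB; apply: le_trans (trace_norm_sqr_le _) _.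
have -> : #|bits (subsystem S)|%:R = 2 ^+ #|S| :> R.
  by rewrite card_ffun card_bool card_sig natrX.
rewrite -ReZ rmorphXn rmorph_nat.
rewrite -pauli_parseval Re_sum; apply: ler_sum => f _.
rewrite pauli_coefB -!pauli_coef_real Re_norm2 /=.
by rewrite subr0 expr0n addr0.
Qed.

End PauliStrings.

(** * Random Pauli measurements *)

Section PauliMeasurement.
Variables (R : realType) (Q : finType).
Implicit Types (X : op R Q) (S : {set Q}) (u v : bits Q) (rho : density R Q).
Implicit Types (P : {ffun Q -> pauli}).

Definition qubit_projection (p : pauli) (s a b : bool) : R[i] :=
  ((a == b)%:R + (-1) ^+ s * pauli_entry R p a b) / 2%:R.

(** The classical shadow of one qubit: the factor [3] makes up for the probability
    [1 / 3] that the random basis [p] is the one of [o]. *)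
Definition shadow (o : option pauli) (p : pauli) (s : bool) : R :=
  if o is Some r then if r == p then 3 * (-1) ^+ s else 0 else 1.

(** The second moment of [shadow]: for a Pauli matrix, the value 9 with probability [1 / 3]. *)
Definition shadow_norm2 (o : option pauli) : R := if o is Some _ then 3 else 1.

Lemma pauli_neq : (((PX == PY) = false) * ((PX == PZ) = false) *
  ((PY == PX) = false) * ((PY == PZ) = false) *
  ((PZ == PX) = false) * ((PZ == PY) = false))%type.
Proof. by do ![split]; apply/eqP. Qed.

Lemma ComplexN1 : Complex 0 (-1) = - Complex 0 1 :> R[i].
Proof. by apply/eqP; rewrite eq_complex /= oppr0 !eqxx. Qed.

Lemma sum_bool (V : nmodType) (F : bool -> V) : \sum_b F b = F true + F false.
Proof. by rewrite big_bool. Qed.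

(** The difference of the two projections of a Pauli matrix is that matrix, and the factor 3 cancels
    the probability [3^-1] of its basis. *)
Lemma shadow_mean o (a b : bool) :
  \sum_p \sum_s (3^-1 * shadow o p s)%:C%C * qubit_projection p s b a =
  opauli_entry R o b a.
Proof.
rewrite big_pauli !sum_bool /qubit_projection /shadow.
by case: o a b => [[]|] [] []; rewrite /= ?pauli_neq ?eqxx /= ?ComplexN1; field.
Qed.

(** The squared shadow does not depend on [s], so the projections add up to the identity and the
    second moment is the same in every state. *)
Lemma shadow_second_moment o a b :
  \sum_p \sum_s (3^-1 * shadow o p s ^+ 2)%:C%C * qubit_projection p s b a =
  (shadow_norm2 o)%:C%C * (b == a)%:R.
Proof.
rewrite big_pauli !sum_bool /qubit_projection /shadow /shadow_norm2.
by case: o a b => [[]|] [] []; rewrite /= ?pauli_neq ?eqxx /= ?ComplexN1; field.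
Qed.

Lemma qubit_projection_herm p (s a b : bool) :
  (qubit_projection p s b a)^* = qubit_projection p s a b.
Proof.
have := opauli_herm R (Some p) a b; rewrite /qubit_projection /= => pE.
rewrite rmorphM rmorphD rmorphM /= pE fmorphV /= rmorph_nat rmorphXn rmorphN1.
by rewrite conjC_nat eq_sym.
Qed.

Lemma qubit_projection_idem p (s a b : bool) :
  \sum_c qubit_projection p s a c * qubit_projection p s c b =
  qubit_projection p s a b.
Proof.
rewrite sum_bool /qubit_projection.
have i2 : Complex 0 1 * Complex 0 1 = -1 :> R[i] by rewrite -expr2 sqr_i.
by case: p s a b => [] [] [] []; rewrite /= ?ComplexN1; field : i2.
Qed.

Lemma qubit_projection_sum p a b :
  \sum_s qubit_projection p s a b = (a == b)%:R.
Proof. by rewrite sum_bool /qubit_projection /=; field. Qed.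

Lemma entry_projection (P : {ffun Q -> pauli}) (s : bits Q) u v :
  entry (pauli_projection R P s) u v =
  \prod_q qubit_projection (P q) (s q) (u q) (v q).
Proof. exact: entry_mkop. Qed.

Lemma prod_eq_bits u v : \prod_q (u q == v q)%:R = (u == v)%:R :> R[i].
Proof.
have [->|uv] := eqVneq; first by rewrite big1 // => q _; rewrite eqxx.
have /existsP[q qn] : [exists q, u q != v q].
  apply: contraNT uv; rewrite negb_exists => /forallP h.
  by apply/eqP/ffunP => q; apply/eqP; have := h q; rewrite negbK.
by rewrite (bigD1 q) //= (negPf qn) mul0r.
Qed.

Lemma projection_herm P (s : bits Q) u v :
  entry (pauli_projection R P s) u v = (entry (pauli_projection R P s) v u)^*.
Proof.
rewrite !entry_projection rmorph_prod; apply: eq_bigr => q _ /=.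
by rewrite qubit_projection_herm.
Qed.

(** [B = B^t* *m B] for a projection [B]; both positivity statements below rest on this form. *)
Lemma projection_gram P (s : bits Q) u v :
  entry (pauli_projection R P s) u v =
  \sum_w (entry (pauli_projection R P s) w u)^* * entry (pauli_projection R P s) w v.
Proof.
under eq_bigr do rewrite -projection_herm !entry_projection -big_split /=.
rewrite -(bigA_distr_bigA (fun q c => qubit_projection (P q) (s q) (u q) c *
  qubit_projection (P q) (s q) c (v q))) /= entry_projection.
by apply: eq_bigr => q _; rewrite qubit_projection_idem.
Qed.

Lemma projection_psd P (s : bits Q) : psd (pauli_projection R P s).
Proof.
apply/psdP; split=> [|w]; first exact: projection_herm.
have -> : \sum_u \sum_v (w u)^* * entry (pauli_projection R P s) u v * w v =
    \sum_c (\sum_v entry (pauli_projection R P s) c v * w v) *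
           (\sum_v entry (pauli_projection R P s) c v * w v)^*.
  under [RHS]eq_bigr do rewrite mulrC rmorph_sum mulr_suml.
  rewrite [RHS]exchange_big /=; apply: eq_bigr => u _.
  under [RHS]eq_bigr do rewrite mulr_sumr.
  rewrite [RHS]exchange_big /=; apply: eq_bigr => v _.
  rewrite projection_gram mulr_sumr mulr_suml; apply: eq_bigr => c _.
  by rewrite rmorphM /= !mulrA; congr (_ * _ * _); rewrite mulrC.
by apply: sumr_ge0 => c _; exact: mul_conjC_ge0.
Qed.

Lemma projection_sum (P : {ffun Q -> pauli}) :
  \sum_s pauli_projection R P s = 1%:M.
Proof.
apply: entryP => u v; rewrite entry1 -prod_eq_bits.
transitivity (\sum_(s : bits Q) \prod_q qubit_projection (P q) (s q) (u q) (v q)).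
  by rewrite /entry summxE; apply: eq_bigr => s _; rewrite -entry_projection.
rewrite -(bigA_distr_bigA (fun q c => qubit_projection (P q) c (u q) (v q))) /=.
by apply: eq_bigr => q _; rewrite qubit_projection_sum.
Qed.

(** The trace is the sum of the quadratic forms of [X] at the conjugated rows of the projection. *)
Lemma tr_projection_ge0 X P (s : bits Q) : psd X -> 0 <= \tr (X *m pauli_projection R P s).
Proof.
move=> /psdP[_ Xq]; rewrite trM_entry.
set B := pauli_projection R P s.
have -> : \sum_u \sum_v entry X u v * entry B v u =
    \sum_w \sum_u \sum_v ((entry B w u)^*)^* * entry X u v * (entry B w v)^*.
  rewrite [RHS]exchange_big /=; apply: eq_bigr => u _.
  rewrite [RHS]exchange_big /=; apply: eq_bigr => v _.
  rewrite projection_gram mulr_sumr; apply: eq_bigr => w _.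
  by rewrite conjCK mulrCA [RHS]mulrC; congr (_ * _); exact: mulrC.
by apply: sumr_ge0 => w _; exact: (Xq (fun u => (entry B w u)^*)).
Qed.

(** Product weights can be summed qubit by qubit, since the projection is a tensor product; means
    and second moments of shadows are both instances. *)
Lemma measurement_sum X (f : Q -> pauli -> bool -> R[i]) :
  \sum_(P : {ffun Q -> pauli}) \sum_(s : bits Q)
     (\prod_q f q (P q) (s q)) * \tr (X *m pauli_projection R P s) =
  \sum_u \sum_v entry X u v *
     \prod_q \sum_p \sum_s f q p s * qubit_projection p s (v q) (u q).
Proof.
transitivity (\sum_u \sum_v \sum_(P : {ffun Q -> pauli}) \sum_(s : bits Q)
   entry X u v * \prod_q (f q (P q) (s q) * qubit_projection (P q) (s q) (v q) (u q))).
  under eq_bigr do under eq_bigr do rewrite trM_entry mulr_sumr.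
  under eq_bigr do rewrite exchange_big.
  rewrite exchange_big; apply: eq_bigr => u _ /=.
  under eq_bigr do under eq_bigr do rewrite mulr_sumr.
  under eq_bigr do rewrite exchange_big.
  rewrite exchange_big; apply: eq_bigr => v _ /=.
  apply: eq_bigr => P _; apply: eq_bigr => s _.
  by rewrite big_split /= entry_projection mulrCA.
apply: eq_bigr => u _; apply: eq_bigr => v _.
under [LHS]eq_bigr do rewrite -mulr_sumr.
rewrite -mulr_sumr; congr (_ * _).
rewrite (bigA_distr_bigA (fun q p => \sum_s f q p s * _)) /=.
apply: eq_bigr => P _.
by rewrite (bigA_distr_bigA (fun q (s : bool) =>
  f q (P q) s * qubit_projection (P q) s (v q) (u q))).
Qed.

(** The joint probability of uniformly random bases [P] and outcomes [s] on one copy. *)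
Definition shot_weight rho (P : {ffun Q -> pauli}) (s : bits Q) : R :=
  3^-1 ^+ #|Q| * born rho (pauli_projection R P s).

Definition shadow_string (f : {ffun Q -> option pauli}) (P : {ffun Q -> pauli})
  (s : bits Q) : R := \prod_q shadow (f q) (P q) (s q).

Lemma born_ge0 rho P (s : bits Q) : 0 <= born rho (pauli_projection R P s).
Proof. by apply: Re_ge0; apply: tr_projection_ge0; exact: density_psd. Qed.

Lemma shot_weight_ge0 rho P (s : bits Q) : 0 <= shot_weight rho P s.
Proof. by rewrite mulr_ge0 ?born_ge0 // exprn_ge0 // invr_ge0 ler0n. Qed.

Lemma shot_weight_prod rho (g : Q -> pauli -> bool -> R) :
  \sum_P \sum_s shot_weight rho P s * \prod_q g q (P q) (s q) =
  complex.Re (\sum_u \sum_v entry rho u v *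
     \prod_q \sum_p \sum_s (3^-1 * g q p s)%:C%C * qubit_projection p s (v q) (u q)).
Proof.
rewrite -(measurement_sum _ (fun q p s => (3^-1 * g q p s)%:C%C)).
rewrite Re_sum; apply: eq_bigr => P _; rewrite Re_sum; apply: eq_bigr => s _.
rewrite -rmorph_prod ReZ big_split /= prodr_const cardT /= -cardE /shot_weight.
by rewrite mulrAC.
Qed.

Lemma shadow_string_mean rho f :
  \sum_P \sum_s shot_weight rho P s * shadow_string f P s = pauli_exp rho f.
Proof.
rewrite (shot_weight_prod _ (fun q => shadow (f q))) /pauli_exp /pauli_coef.
congr complex.Re; apply: eq_bigr => u _; apply: eq_bigr => v _; congr (_ * _).
by apply: eq_bigr => q _; rewrite shadow_mean.
Qed.

Lemma pauli_exp_None X : pauli_exp X [ffun=> None] = complex.Re (\tr X).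
Proof.
rewrite /pauli_exp /pauli_coef tr_entry; congr complex.Re; apply: eq_bigr => u _.
rewrite (bigD1 u) //= big1 => [|q _]; last by rewrite ffunE /= eqxx.
rewrite mulr1 big1 ?addr0 // => v vu.
under eq_bigr do rewrite ffunE /=.
by rewrite prod_eq_bits (negPf vu) mulr0.
Qed.

Lemma shot_weight_sum rho : \sum_P \sum_s shot_weight rho P s = 1.
Proof.
have := shadow_string_mean rho [ffun=> None]; rewrite pauli_exp_None density_tr /= => <-.
apply: eq_bigr => P _; apply: eq_bigr => s _; rewrite /shadow_string big1 ?mulr1 //.
by move=> q _; rewrite ffunE.
Qed.

(** Origin of the base 10: a qubit of [S] contributes [1 + 3 * 3] over its four choices, any other
    qubit contributes 1. *)
Lemma shadow_string_second_moment rho S :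
  \sum_(f in pauli_strings S) \sum_P \sum_s shot_weight rho P s * shadow_string f P s ^+ 2
  = 10 ^+ #|S|.
Proof.
transitivity (\sum_(f in pauli_strings S) \prod_q shadow_norm2 (f q)).
  apply: eq_bigr => f _.
  under [LHS]eq_bigr do under eq_bigr do rewrite /shadow_string -prodrXl.
  rewrite (shot_weight_prod _ (fun q p s => shadow (f q) p s ^+ 2)).
  transitivity (complex.Re ((\prod_q shadow_norm2 (f q))%:C%C * \tr rho)); last first.
    by rewrite ReZ density_tr mulr1.
  rewrite tr_entry mulr_sumr; congr complex.Re; apply: eq_bigr => u _.
  transitivity (\sum_v entry rho u v * ((\prod_q shadow_norm2 (f q))%:C%C * (v == u)%:R)).
    apply: eq_bigr => v _; congr (_ * _); rewrite rmorph_prod /= -prod_eq_bits -big_split.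
    by apply: eq_bigr => q _; rewrite shadow_second_moment.
  rewrite (bigD1 u) //= eqxx mulr1 [LHS]addrC big1 ?add0r 1?mulrC //.
  by move=> v /negPf ->; rewrite !mulr0.
rewrite -(bigA_distr_big_dep (fun q o => (q \in S) || (o == None))
  (fun q o => shadow_norm2 o)) (bigID (mem S)) /= [X in _ * X]big1 ?mulr1 => [|q /negPf qS].
  rewrite -prodr_const; apply: eq_bigr => q ->.
  by rewrite /= big_option big_pauli /=; ring.
by rewrite qS big_pred1_eq.
Qed.

End PauliMeasurement.

(** * Median of means *)

Section ProductWeights.
Variables (R : realType) (T : finType) (w : T -> R).
Hypotheses (w_ge0 : forall t, 0 <= w t) (w_sum : \sum_t w t = 1).

Definition prod_weight (I : finType) (x : {ffun I -> T}) : R := \prod_i w (x i).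

Lemma prod_weight_ge0 (I : finType) (x : {ffun I -> T}) : 0 <= prod_weight x.
Proof. by apply: prodr_ge0. Qed.

Lemma prod_weightM (I : finType) (f : I -> T -> R) :
  \sum_(x : {ffun I -> T}) prod_weight x * \prod_i f i (x i) =
  \prod_i \sum_t w t * f i t.
Proof.
rewrite (bigA_distr_bigA (fun i t => w t * f i t)); apply: eq_bigr => x _.
by rewrite big_split.
Qed.

Lemma prod_weight_sum (I : finType) : \sum_(x : {ffun I -> T}) prod_weight x = 1.
Proof.
transitivity (\sum_(x : {ffun I -> T}) prod_weight x * \prod_(i : I) 1).
  by apply: eq_bigr => x _; rewrite big1_eq mulr1.
rewrite (prod_weightM (fun _ _ => 1)) big1 // => i _.
by under eq_bigr do rewrite mulr1.
Qed.

(** By independence, a centered factor [z (x i)] with [i != j] averages to zero. *)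
Lemma prod_weight_cross (I : finType) (z : T -> R) (i j : I) :
  \sum_t w t * z t = 0 ->
  \sum_(x : {ffun I -> T}) prod_weight x * (z (x i) * z (x j)) =
  (i == j)%:R * \sum_t w t * z t ^+ 2.
Proof.
move=> z0.
transitivity (\prod_k \sum_t w t * ((if k == i then z t else 1) * (if k == j then z t else 1))).
  rewrite -prod_weightM; apply: eq_bigr => x _; congr (_ * _).
  by rewrite big_split /= -!big_mkcond !big_pred1_eq.
rewrite (bigD1 i) //= eqxx; case: eqVneq => [->|ij].
  rewrite [X in _ * X]big1 => [|k /negPf kj].
    by rewrite mulr1 mul1r; apply: eq_bigr => t _; rewrite expr2.
  by rewrite kj; under eq_bigr do rewrite !mulr1.
under eq_bigr do rewrite mulr1.
by rewrite z0 !mul0r.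
Qed.

Lemma prod_weight_variance (I : finType) (z : T -> R) :
  \sum_t w t * z t = 0 ->
  \sum_(x : {ffun I -> T}) prod_weight x * (\sum_i z (x i)) ^+ 2 =
  #|I|%:R * \sum_t w t * z t ^+ 2.
Proof.
move=> z0.
transitivity (\sum_i \sum_j \sum_(x : {ffun I -> T}) prod_weight x * (z (x i) * z (x j))).
  under eq_bigr do rewrite expr2 mulr_suml mulr_sumr.
  rewrite exchange_big; apply: eq_bigr => i _ /=.
  under eq_bigr do rewrite mulr_sumr mulr_sumr.
  by rewrite exchange_big.
rewrite mulr_natl -sumr_const; apply: eq_bigr => i _.
under eq_bigr do rewrite prod_weight_cross //.
rewrite (bigD1 i) //= eqxx mul1r [X in _ + X]big1 ?addr0 // => j.
by rewrite eq_sym => /negPf ->; rewrite mul0r.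
Qed.

Lemma variance_le (y : T -> R) (m : R) : m = \sum_t w t * y t ->
  \sum_t w t * (y t - m) ^+ 2 = \sum_t w t * y t ^+ 2 - m ^+ 2.
Proof.
move=> mE.
transitivity (\sum_t w t * y t ^+ 2 - 2 * m * (\sum_t w t * y t) + m ^+ 2 * \sum_t w t).
  rewrite !mulr_sumr -sumrB -big_split; apply: eq_bigr => t _ /=; ring.
by rewrite w_sum -mE; ring.
Qed.

Definition sample_mean (I : finType) (y : T -> R) (x : {ffun I -> T}) : R :=
  #|I|%:R^-1 * \sum_i y (x i).

Section Batch.
Variables (D : finType) (A : {pred D}) (y : D -> T -> R) (mean : D -> R) (v r : R).
Hypothesis meanE : forall d, \sum_t w t * y d t = mean d.
Hypothesis v_ge : \sum_(d in A) \sum_t w t * y d t ^+ 2 <= v.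

Definition batch_error (I : finType) (mu : D -> R) (x : {ffun I -> T}) : R :=
  \sum_(d in A) (sample_mean (y d) x - mu d) ^+ 2.

(** Variances are nonnegative. This bounds the Pauli coordinates of every state, for use when [eps]
    is large. *)
Lemma mean_sqr_le : \sum_(d in A) mean d ^+ 2 <= v.
Proof.
apply: le_trans v_ge; apply: ler_sum => d _.
rewrite -subr_ge0 -(variance_le (esym (meanE d))).
by apply: sumr_ge0 => t _; rewrite mulr_ge0 ?sqr_ge0.
Qed.

(** In each coordinate the variance of the sample mean is the single-shot variance over [#|I|], and
    a variance is at most the second moment. *)
Lemma batch_error_mean (I : finType) : (0 < #|I|)%N ->
  \sum_(x : {ffun I -> T}) prod_weight x * batch_error mean x <= v / #|I|%:R.
Proof.
move=> I0; have I0' : #|I|%:R != 0 :> R by rewrite pnatr_eq0 -lt0n.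
under eq_bigr do rewrite mulr_sumr.
rewrite exchange_big /= ler_pdivlMr ?ltr0n // mulr_suml.
apply: le_trans v_ge; apply: ler_sum => d _.
pose z t := y d t - mean d.
have z0 : \sum_t w t * z t = 0.
  under eq_bigr do rewrite mulrBr.
  by rewrite sumrB meanE -mulr_suml w_sum mul1r subrr.
have -> : \sum_(x : {ffun I -> T}) prod_weight x * (sample_mean (y d) x - mean d) ^+ 2 =
   #|I|%:R^-1 ^+ 2 * \sum_(x : {ffun I -> T}) prod_weight x * (\sum_i z (x i)) ^+ 2.
  rewrite mulr_sumr; apply: eq_bigr => x _; rewrite [RHS]mulrCA -exprMn; congr (_ * _ ^+ 2).
  by rewrite sumrB sumr_const mulrBr /sample_mean -[mean d *+ _]mulr_natl mulKf.
rewrite prod_weight_variance //.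
have -> : #|I|%:R^-1 ^+ 2 * (#|I|%:R * \sum_t w t * z t ^+ 2) * #|I|%:R =
   \sum_t w t * z t ^+ 2 by field.
by rewrite (variance_le (esym (meanE d))) lerBlDr lerDl sqr_ge0.
Qed.

(** Markov's inequality for the total squared error, whose mean is at most [r / 16] at this batch
    size. *)
Lemma batch_chebyshev (I : finType) : (0 < #|I|)%N -> 0 < r ->
  16 * v <= #|I|%:R * r ->
  \sum_(x : {ffun I -> T} | r < batch_error mean x) prod_weight x <= 16^-1.
Proof.
move=> I0 r0 vr.
rewrite -(ler_pM2l r0).
apply: le_trans (le_trans (batch_error_mean I0) _).
  rewrite mulr_sumr big_mkcond /=; apply: ler_sum => x _.
  have e0 : 0 <= batch_error mean x by apply: sumr_ge0 => d _; exact: sqr_ge0.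
  case: ifP => [rx|_]; last by rewrite mulr_ge0 ?prod_weight_ge0.
  by rewrite mulrC ler_wpM2l ?prod_weight_ge0 // ltW.
by rewrite ler_pdivrMr ?ltr0n //; lra.
Qed.

End Batch.
End ProductWeights.

Section MedianOfMeans.
Variables (R : realType) (T B J : finType) (w : T -> R) (bad : J -> {pred T}).
Hypotheses (w_ge0 : forall t, 0 <= w t) (w_sum : \sum_t w t = 1).
Hypothesis bad_small : forall j, \sum_(t in bad j) w t <= 16^-1.

Definition mostly_good (j : J) (x : {ffun B -> T}) : bool :=
  (#|[set b | x b \in bad j]| * 2 < #|B|)%N.

(** Markov's inequality for the product of [4] over the bad batches and [1 / 4] over
    the other ones. *)
Lemma many_bad_le j :
  \sum_(x : {ffun B -> T} | ~~ mostly_good j x) prod_weight w x <= 2^-1 ^+ #|B|.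
Proof.
pose f t : R := if t \in bad j then 4 else 4^-1.
have f0 t : 0 <= f t by rewrite /f; case: ifP.
apply: (@le_trans _ _ (\sum_(x : {ffun B -> T}) prod_weight w x * \prod_b f (x b))).
  rewrite big_mkcond /=; apply: ler_sum => x _; case: ifPn => [|_]; last first.
    by rewrite mulr_ge0 ?prod_weight_ge0 // prodr_ge0.
  rewrite -leqNgt => xb; rewrite ler_peMr ?prod_weight_ge0 //.
  rewrite (bigID (fun b => x b \in bad j)) /=.
  under eq_bigr => b xbb do rewrite /f xbb.
  under [X in _ * X]eq_bigr => b xbb do rewrite /f (negPf xbb).
  rewrite !prodr_const.
  have c1 : #|[pred b | x b \in bad j]| = #|[set b | x b \in bad j]|.
    by apply: eq_card => b; rewrite !inE.
  have c2 : (#|[set b | x b \in bad j]| + #|[pred b | x b \notin bad j]|)%N = #|B|.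
    by rewrite -c1 cardC.
  have {c2}c2 : (#|[pred b | x b \notin bad j]| <= #|[pred b | x b \in bad j]|)%N.
    by rewrite c1; lia.
  by rewrite exprVn ler_pdivlMr ?exprn_gt0 // mul1r ler_weXn2l // ler1n.
rewrite (prod_weightM w (fun _ => f)) prodr_const.
apply: lerXn2r.
- by rewrite nnegrE; apply: sumr_ge0 => t _; rewrite mulr_ge0.
- by rewrite nnegrE.
(* The mean of [f] is at most [4^-1 + 4 / 16 = 2^-1]. *)
apply: (@le_trans _ _ (\sum_t (4^-1 * w t + 4 * (if t \in bad j then w t else 0)))).
  apply: ler_sum => t _; rewrite /f; have := w_ge0 t; case: ifP => _; lra.
rewrite big_split /= -!mulr_sumr w_sum -big_mkcond.
by have := bad_small j; lra.
Qed.

(** Union bound over [J], each failure having weight at most [2^-1 ^+ #|B|]. *)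
Lemma all_mostly_good (delta : R) : #|J|%:R <= delta * 2 ^+ #|B| ->
  1 - delta <= \sum_(x : {ffun B -> T} | [forall j, mostly_good j x]) prod_weight w x.
Proof.
move=> Jd.
have := prod_weight_sum w_sum B.
rewrite (bigID (fun x => [forall j, mostly_good j x])) /= => e.
suff : \sum_(x : {ffun B -> T} | ~~ [forall j, mostly_good j x]) prod_weight w x <= delta.
  by lra.
apply: (@le_trans _ _ (\sum_j \sum_(x : {ffun B -> T} | ~~ mostly_good j x) prod_weight w x)).
  under [leRHS]eq_bigr do rewrite big_mkcond.
  rewrite exchange_big big_mkcond /=; apply: ler_sum => x _.
  case: ifPn => [|_]; last by apply: sumr_ge0 => j _; case: ifP => // _; exact: prod_weight_ge0.
  rewrite negb_forall => /existsP[j jx]; rewrite (bigD1 j) //= jx lerDl.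
  by apply: sumr_ge0 => i _; case: ifP => // _; exact: prod_weight_ge0.
apply: le_trans (ler_sum _ (fun j _ => many_bad_le j)) _.
rewrite sumr_const -[leLHS]mulr_natl exprVn ler_pdivrMr ?exprn_gt0 //.
Qed.

End MedianOfMeans.

(** Pigeonhole: each set of bad batches is less than half of [B], so their union is not all of
    it. *)
Lemma mostly_good_meet (T B J : finType) (bad bad' : J -> {pred T}) j (x : {ffun B -> T}) :
  mostly_good bad j x -> mostly_good bad' j x ->
  exists b, x b \notin bad j /\ x b \notin bad' j.
Proof.
rewrite /mostly_good => h h'.
set U := [set b | x b \in bad j] :|: [set b | x b \in bad' j].
have Ucard : (#|U| < #|B|)%N.
  by have [+ _] := leq_card_setU [set b | x b \in bad j] [set b | x b \in bad' j]; rewrite -/U; lia.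
have /existsP[b] : [exists b, b \notin U].
  apply: contraLR Ucard; rewrite negb_exists => /forallP all; rewrite -leqNgt.
  by apply/subset_leq_card/fintype.subsetP => b _; have := all b; rewrite negbK.
by rewrite !inE negb_or => /andP[? ?]; exists b.
Qed.

(** * Tomography with Pauli measurements *)

Section DiagonalStates.
Variables (R : realType) (Q : finType) (p : bits Q -> R).
Hypotheses (p_ge0 : forall u, 0 <= p u) (p_sum : \sum_u p u = 1).

Definition diag_op : op R Q := mkop (fun u v => (p u)%:C%C * (u == v)%:R).

Lemma diag_op_psd : psd diag_op.
Proof.
apply/psdP; split=> [u v|w].
  rewrite !entry_mkop eq_sym; case: eqP => [->|_].
    by rewrite !mulr1; apply/esym/CrealP; rewrite complex_real.
  by rewrite !mulr0 rmorph0.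
apply: sumr_ge0 => u _; rewrite (bigD1 u) //= big1 => [|v /negPf vu].
  rewrite addr0 entry_mkop eqxx mulr1 mulrAC mulr_ge0 ?ler0c //.
  by rewrite mulrC mul_conjC_ge0.
by rewrite entry_mkop eq_sym vu !mulr0 mul0r.
Qed.

Lemma diag_op_tr : \tr diag_op = 1.
Proof.
rewrite tr_entry -[RHS]/(1%:C%C) -p_sum rmorph_sum; apply: eq_bigr => u _ /=.
by rewrite entry_mkop eqxx mulr1.
Qed.

Definition diag_density : density R Q := Density diag_op_psd diag_op_tr.

End DiagonalStates.

Lemma density_inhabited (R : realType) (Q : finType) : inhabited (density R Q).
Proof.
pose p (u : bits Q) : R := (u == [ffun=> false])%:R.
have p0 u : 0 <= p u by rewrite ler0n.
have p1 : \sum_u p u = 1.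
  rewrite (bigD1 [ffun=> false]) //= /p eqxx big1 ?addr0 // => u /negPf.
  by move=> ->.
by split; exact: diag_density p0 p1.
Qed.

Lemma prod_mxvec_index (R : comPzSemiRingType) (b L : nat) (F : 'I_(b * L) -> R) :
  \prod_c F c = \prod_(i < b) \prod_(l < L) F (mxvec_index i l).
Proof.
rewrite pair_big /= (reindex (uncurry (@mxvec_index b L))); last exact: curry_mxvec_bij.
by apply: eq_bigr => -[].
Qed.

(** * Copies grouped into [b] independent batches of [L] shots *)

Section Batches.
Variables (R : realType) (n b L : nat).

Definition shot : finType := ({ffun 'I_n -> pauli} * bits 'I_n)%type.

Definition batches (P : {ffun 'I_(b * L) * 'I_n -> pauli})
    (s : bits ('I_(b * L) * 'I_n)%type) : {ffun 'I_b -> {ffun 'I_L -> shot}} :=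
  [ffun i => [ffun l => (copy_of P (mxvec_index i l), copy_of s (mxvec_index i l))]].

Lemma card_pauli : #|{: pauli}| = 3%N.
Proof. by rewrite -sum1_card big_pauli. Qed.

(** Injectivity is read off copy by copy; surjectivity follows by counting. *)
Lemma batches_bij : bijective (fun x => batches x.1 x.2).
Proof.
apply: inj_card_bij => [[P s] [P' s'] /= /ffunP e|].
  have {}e c q : P (c, q) = P' (c, q) /\ s (c, q) = s' (c, q).
    case/mxvec_indexP: c => i l.
    have /ffunP/(_ l) := e i; rewrite !ffunE => -[/ffunP/(_ q) + /ffunP/(_ q)].
    by rewrite !ffunE.
  by congr pair; apply/ffunP => -[c q]; have [] := e c q.
rewrite !(card_prod, card_ffun) !card_pauli !card_bool !card_ord.
by rewrite -!expnMn -!expnM leq_exp2l //; lia.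
Qed.

Definition shot_distr (rho : density R 'I_n) (x : shot) : R := shot_weight rho x.1 x.2.

Lemma shot_distr_ge0 rho x : 0 <= shot_distr rho x.
Proof. exact: shot_weight_ge0. Qed.

Lemma shot_distr_sum rho : \sum_x shot_distr rho x = 1.
Proof. by rewrite -(shot_weight_sum rho) pair_big. Qed.

Definition batch_distr (rho : density R 'I_n) (x : {ffun 'I_L -> shot}) : R :=
  prod_weight (shot_distr rho) x.

Lemma batch_distr_ge0 rho x : 0 <= batch_distr rho x.
Proof. by apply: prod_weight_ge0 => t; exact: shot_distr_ge0. Qed.

Lemma batch_distr_sum rho : \sum_x batch_distr rho x = 1.
Proof. by apply: prod_weight_sum; exact: shot_distr_sum. Qed.

Lemma batches_weight rho P s :
  3^-1 ^+ (b * L * n) * pauli_prob rho P s =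
  prod_weight (batch_distr rho) (batches P s).
Proof.
rewrite /pauli_prob prod_mxvec_index /prod_weight /batch_distr.
have -> : 3^-1 ^+ (b * L * n) = \prod_(i < b) \prod_(l < L) 3^-1 ^+ n :> R.
  by rewrite !prodr_const !card_ord -!exprM; congr (_ ^+ _); lia.
rewrite -big_split; apply: eq_bigr => i _; rewrite -big_split; apply: eq_bigr => l _.
by rewrite /= !ffunE /shot_distr /shot_weight /= card_ord.
Qed.

(** The bases are drawn uniformly; the change of variables [batches] turns bases and outcomes into
    independent batches. *)
Lemma pauli_achieves_batches (I : finType) (F : I -> {set 'I_n}) (eps delta : R)
    (est : {ffun 'I_b -> {ffun 'I_L -> shot}} -> forall i, density R (subsystem (F i))) :
  (forall rho : density R 'I_n,
     1 - delta <= \sum_(x | accurate eps rho (est x))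
                    prod_weight (batch_distr rho) x) ->
  pauli_achieves F eps delta (b * L).
Proof.
move=> est_ok; exists (fun=> 3^-1 ^+ (b * L * n)), (fun P s => est (batches P s)).
split=> [P||rho]; first by rewrite exprn_ge0.
  rewrite sumr_const -[LHS]mulr_natl card_ffun card_prod !card_ord card_pauli.
  by rewrite natrX exprVn divff // expf_neq0.
apply: le_trans (est_ok rho) _; rewrite le_eqVlt; apply/orP; left; apply/eqP.
rewrite (reindex (fun x => batches x.1 x.2)); last exact: onW_bij batches_bij.
under [RHS]eq_bigr do rewrite mulr_sumr big_mkcond.
rewrite pair_big big_mkcond /=; apply: eq_bigr => -[P s] _ /=.
by rewrite batches_weight.
Qed.

End Batches.

(** * Tomography of sets [F i], each covered by a set [G (g i)] of at most [k] qubits *)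

Section PauliTomography.
Variables (R : realType) (n k : nat) (I J : finType).
Variables (F : I -> {set 'I_n}) (G : J -> {set 'I_n}) (g : I -> J).
Hypotheses (FG : forall i, F i \subset G (g i)) (Gk : forall j, (#|G j| <= k)%N).
Variables (eps delta : R).
Hypotheses (eps_gt0 : 0 < eps).

Let shadow_coord (f : {ffun 'I_n -> option pauli}) (x : shot n) : R :=
  shadow_string R f x.1 x.2.

Lemma shadow_coord_mean (rho : density R 'I_n) f :
  \sum_x shot_distr rho x * shadow_coord f x = pauli_exp rho f.
Proof. by rewrite -shadow_string_mean pair_big. Qed.

Lemma shadow_coord_moment (rho : density R 'I_n) j :
  \sum_(f in pauli_strings (G j)) \sum_x shot_distr rho x * shadow_coord f x ^+ 2
  <= 10 ^+ k.
Proof.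
apply: (@le_trans _ _ (10 ^+ #|G j|)); last by rewrite ler_weXn2l ?Gk // ler1n.
rewrite -(shadow_string_second_moment rho) le_eqVlt; apply/orP; left; apply/eqP.
by apply: eq_bigr => f _; rewrite pair_big.
Qed.

Lemma trace_norm_reduced_lt (rho tau : density R 'I_n) i (e : R) :
  pauli_dist2 (G (g i)) (pauli_exp rho) (pauli_exp tau) <= e -> e < eps ^+ 2 ->
  trace_norm (reduced (F i) rho - reduced (F i) tau) < eps.
Proof.
move=> de ee; rewrite -(ltr_pXn2r (n := 2)) ?nnegrE ?trace_norm_ge0 ?ltW //.
apply: le_lt_trans ee; apply: le_trans de.
exact: le_trans (trace_norm_pauli _ _ _) (pauli_dist2_mono _ _ (FG i)).
Qed.

(** Triangle inequality through a common estimate [c]: the gap in each coordinate is the square of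
    the sum of the two deviations. *)
Lemma pauli_dist2_le j (rho tau : density R 'I_n) (x y z : R)
    (c : {ffun 'I_n -> option pauli} -> R) :
  \sum_(f in pauli_strings (G j)) (c f - pauli_exp rho f) ^+ 2 <= x ->
  \sum_(f in pauli_strings (G j)) (c f - pauli_exp tau f) ^+ 2 <= y ->
  pauli_dist2 (G j) (pauli_exp rho) (pauli_exp tau) <= 2 * (x + y).
Proof.
move=> hx hy; apply: (@le_trans _ _ (2 *
  (\sum_(f in pauli_strings (G j)) (c f - pauli_exp rho f) ^+ 2 +
   \sum_(f in pauli_strings (G j)) (c f - pauli_exp tau f) ^+ 2))); last by lra.
rewrite -big_split mulr_sumr; apply: ler_sum => f _ /=.
by have := sqr_ge0 ((c f - pauli_exp rho f) + (c f - pauli_exp tau f)); lra.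
Qed.

(** The squared coordinates of any state on [G j] sum to at most [10 ^+ k], so any two states are
    within squared distance [4 * 10 ^+ k] and a fixed guess succeeds. *)
Lemma pauli_achieves_large_eps : 0 < delta -> 4 * 10 ^+ k < eps ^+ 2 ->
  pauli_achieves F eps delta 0.
Proof.
move=> d0 epsk; have [tau] := density_inhabited R 'I_n.
rewrite -[0%N]/(0 * 0)%N.
apply: (@pauli_achieves_batches R n 0 0 I F eps delta
         (fun _ i => reduced_density (F i) tau)) => rho.
rewrite (eq_bigl xpredT) => [|x]; last first.
  apply/forallP => i /=; apply: trace_norm_reduced_lt epsk.
  have m (sigma : density R 'I_n) :
      \sum_(f in pauli_strings (G (g i))) (0 - pauli_exp sigma f) ^+ 2 <= 10 ^+ k.
    under eq_bigr do rewrite sub0r sqrrN.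
    exact: (mean_sqr_le (shot_distr_ge0 sigma) (shot_distr_sum sigma)
             (shadow_coord_mean sigma) (shadow_coord_moment sigma _)).
  by apply: le_trans (pauli_dist2_le 0 (m rho) (m tau)) _; lra.
by rewrite prod_weight_sum; [lra|exact: batch_distr_sum].
Qed.

Lemma pauli_achieves_median (b L : nat) : (0 < L)%N ->
  256 * 10 ^+ k <= L%:R * eps ^+ 2 -> #|J|%:R <= delta * 2 ^+ b ->
  pauli_achieves F eps delta (b * L).
Proof.
move=> L0 Lk bJ.
(* Two states within [r] of the same batch are at squared distance at most
   [2 * (r + r) = eps ^+ 2 / 4]. The constant 256 is this 16 times the 16 of Markov's inequality. *)
pose r := eps ^+ 2 / 16.
have r0 : 0 < r by rewrite divr_gt0 ?exprn_gt0.
pose bad (rho : density R 'I_n) j : {pred {ffun 'I_L -> shot n}} :=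
  [pred x | r < batch_error (pauli_strings (G j)) shadow_coord (pauli_exp rho) x].
pose good (x : {ffun 'I_b -> {ffun 'I_L -> shot n}}) rho : bool :=
  [forall j, mostly_good (bad rho) j x].
have [tau0] := density_inhabited R 'I_n.
(* The default [tau0] is never reached on the event [good x rho], where [rho] itself is a
   candidate. *)
pose pick x : density R 'I_n :=
  if pselect (exists tau, good x tau) is left h then projT1 (cid h) else tau0.
have pickP x rho : good x rho -> good x (pick x).
  move=> h; rewrite /pick; case: pselect => [h'|[]]; last by exists rho.
  exact: (projT2 (cid h')).
apply: (@pauli_achieves_batches R n b L I F eps delta
         (fun x i => reduced_density (F i) (pick x))) => rho.
have w0 := shot_distr_ge0 rho; have w1 := shot_distr_sum rho.
apply: (@le_trans _ _ (\sum_(x | good x rho)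
    prod_weight (batch_distr rho) x)).
  apply: all_mostly_good; rewrite ?card_ord //.
  - exact: batch_distr_ge0.
  - exact: batch_distr_sum.
  - move=> j; apply: (batch_chebyshev w0 w1 (shadow_coord_mean rho)
                      (shadow_coord_moment rho j)) => //; rewrite card_ord //.
    by rewrite /r; lra.
rewrite big_mkcond [leRHS]big_mkcond /=; apply: ler_sum => x _.
have x0 : 0 <= prod_weight (batch_distr rho) x.
  by apply: prod_weight_ge0 => t; exact: batch_distr_ge0.
case: (boolP (good x rho)) => [gx|_]; last by case: ifP.
rewrite ifT //; apply/forallP => i /=.
apply: (@trace_norm_reduced_lt _ _ _ (2 * (r + r))); last first.
  by rewrite /r; have := exprn_gt0 2 eps_gt0; lra.
have /forallP/(_ (g i)) h1 := gx; have /forallP/(_ (g i)) h2 := pickP _ _ gx.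
have [c []] := mostly_good_meet h1 h2.
rewrite !inE -!leNgt; exact: pauli_dist2_le.
Qed.

Lemma pauli_tomography : (0 < #|J|)%N -> 0 < delta -> delta < 1 ->
  exists m : nat, pauli_achieves F eps delta m /\
    m%:R <= 1040 * (10 ^+ k * ln (2 * #|J|%:R / delta) / eps ^+ 2).
Proof.
move=> J0 d0 d1.
set l := ln _; set a := 10 ^+ k / eps ^+ 2.
have e2 : 0 < eps ^+ 2 by rewrite exprn_gt0.
have J1 : 1 <= #|J|%:R :> R by rewrite ler1n.
have x2 : 2 <= 2 * #|J|%:R / delta by rewrite ler_pdivlMr //; nra.
(* The factor 2 in the logarithm keeps [l] away from zero: [expR 2^-1 <= 2], because
   [expR (- 2^-1) >= 1 - 2^-1]. *)
have l2 : 2^-1 <= l.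
  rewrite /l -[leLHS]expRK ler_ln ?posrE ?expR_gt0 //; last by lra.
  apply: le_trans x2.
  have := expR_ge1Dx (- 2^-1 : R); rewrite expRN => h.
  have h' : 2^-1 <= (expR 2^-1)^-1 :> R by lra.
  by rewrite -[leLHS]invrK -[leRHS]invrK lef_pV2 ?posrE ?invr_gt0 ?expR_gt0.
have aE : 10 ^+ k * l / eps ^+ 2 = a * l by rewrite /a mulrAC.
rewrite aE.
have a0 : 0 < a by rewrite divr_gt0 ?exprn_gt0.
(* For large [eps] the claimed bound can fall below one copy, hence zero copies; otherwise
   [a >= 1 / 4]. *)
have [big_eps|small_eps] := ltP (4 * 10 ^+ k) (eps ^+ 2).
  exists 0%N; split; first exact: pauli_achieves_large_eps.
  have al : 0 <= a * l by apply: mulr_ge0; [exact: ltW|lra].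
  by rewrite mulr0n; lra.
have a4 : 4^-1 <= a by rewrite /a ler_pdivlMr //; lra.
(* Rounding up is absorbed: [a >= 1 / 4] gives [L <= 260 * a] and [l >= 1 / 2] gives [b <= 4 * l],
   whence [1040 = 4 * 260]. *)
pose L := (Num.trunc (256 * a)).+1; pose b := (Num.trunc (2 * l)).+1.
have Lgt : 256 * a < L%:R by exact: truncnS_gt.
have bgt : 2 * l < b%:R by exact: truncnS_gt.
have Lle : L%:R <= 260 * a.
  have : (Num.trunc (256 * a))%:R <= 256 * a by rewrite truncn_le; lra.
  by rewrite /L -natr1; lra.
have ble : b%:R <= 4 * l.
  have : (Num.trunc (2 * l))%:R <= 2 * l by rewrite truncn_le; lra.
  by rewrite /b -natr1; lra.
exists (b * L)%N; split; last first.
  rewrite natrM; apply: (@le_trans _ _ ((4 * l) * (260 * a))).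
    by apply: ler_pM.
  by rewrite le_eqVlt; apply/orP; left; apply/eqP; ring.
apply: pauli_achieves_median => //.
  by have := ltW Lgt; rewrite /a mulrA ler_pdivrMr.
have Jl : 2 * #|J|%:R / delta = expR l by rewrite /l lnK // posrE; lra.
have J2 : #|J|%:R <= delta * expR l.
  by rewrite -Jl mulrCA divff ?gt_eqF // mulr1; lra.
apply: le_trans J2 _; rewrite ler_pM2l //.
(* With [b > 2 * l] this yields [2 ^+ b >= expR l]. *)
have ln2 : 2^-1 <= ln 2 :> R.
  rewrite -[leLHS]expRK ler_ln ?posrE ?expR_gt0 //.
  have := expR_ge1Dx (- 2^-1 : R); rewrite expRN => h.
  have h' : 2^-1 <= (expR 2^-1)^-1 :> R by lra.
  by rewrite -[leLHS]invrK -[leRHS]invrK lef_pV2 ?posrE ?invr_gt0 ?expR_gt0.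
have -> : 2 ^+ b = expR (b%:R * ln 2) :> R.
  by rewrite expRM_natl lnK // posrE.
rewrite ler_expR; nra.
Qed.

End PauliTomography.

(** * Pauli measurements as joint measurements *)

Section PositiveOperators.
Variables (R : realType) (Q : finType).

Lemma entry_sum (I : finType) (P : pred I) (A : I -> op R Q) u v :
  entry (\sum_(i | P i) A i) u v = \sum_(i | P i) entry (A i) u v.
Proof. by rewrite /entry summxE. Qed.

Lemma quad_sum (I : finType) (P : pred I) (A : I -> op R Q) w :
  quad (\sum_(i | P i) A i) w = \sum_(i | P i) quad (A i) w.
Proof. by rewrite /quad mulmx_sumr mulmx_suml summxE. Qed.

Lemma psd_sum (I : finType) (P : pred I) (A : I -> op R Q) :
  (forall i, P i -> psd (A i)) -> psd (\sum_(i | P i) A i).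
Proof.
move=> A_psd; apply/psdP; split=> [u v|w].
  rewrite !entry_sum rmorph_sum; apply: eq_bigr => i Pi.
  by have /psdP[-> _] := A_psd i Pi.
have -> : \sum_u \sum_v (w u)^* * entry (\sum_(i | P i) A i) u v * w v =
    \sum_(i | P i) \sum_u \sum_v (w u)^* * entry (A i) u v * w v.
  rewrite [RHS]exchange_big; apply: eq_bigr => u _ /=.
  rewrite [RHS]exchange_big; apply: eq_bigr => v _ /=.
  by rewrite entry_sum mulr_sumr mulr_suml.
by apply: sumr_ge0 => i Pi; have /psdP[_] := A_psd i Pi; apply.
Qed.

Lemma psdZ (a : R) (A : op R Q) : 0 <= a -> psd A -> psd (a%:C%C *: A).
Proof.
move=> a0 /psdP[Ah Aq]; apply/psdP.
have eZ u v : entry (a%:C%C *: A) u v = a%:C%C * entry A u v by rewrite /entry mxE.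
split=> [u v|w]; first by rewrite !eZ Ah rmorphM; congr (_ * _); rewrite [RHS]conjc_real.
have -> : \sum_u \sum_v (w u)^* * entry (a%:C%C *: A) u v * w v =
    a%:C%C * \sum_u \sum_v (w u)^* * entry A u v * w v.
  rewrite mulr_sumr; apply: eq_bigr => u _; rewrite mulr_sumr; apply: eq_bigr => v _.
  by rewrite eZ; ring.
by rewrite mulr_ge0 ?ler0c.
Qed.

Lemma Re_quad_ge0 (A : op R Q) w : psd A -> 0 <= complex.Re (quad A w).
Proof. by case=> _ /(_ w) /Re_ge0. Qed.

End PositiveOperators.

(** * Finite POVMs with outcomes coded as natural numbers *)

Section DiscretePovm.
Variables (R : realType) (Q : finType) (K : nat) (e : nat -> op R Q).
Hypotheses (e_psd : forall i, psd (e i)) (e_sum : \sum_(i < K) e i = 1%:M).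

Definition discrete_effect (A : set nat) : op R Q :=
  \sum_(i < K | `[< A i >]) e i.

Lemma discrete_effect_psd A : measurable A -> psd (discrete_effect A).
Proof. by move=> _; exact: psd_sum. Qed.

Lemma discrete_effect_setT : discrete_effect setT = 1%:M.
Proof. by rewrite -e_sum; apply: eq_bigl => i; rewrite asboolT. Qed.

(** For a fixed vector this is a finite sum of Dirac measures with nonnegative weights. *)
Lemma discrete_effect_additive (w : 'cV[R[i]]_#|bits Q|) :
  semi_sigma_additive (fun A => (complex.Re (quad (discrete_effect A) w))%:E).
Proof.
pose m i : {measure set nat -> \bar R} :=
  mscale (NngNum (Re_quad_ge0 w (e_psd i))) \d_i.
have -> : (fun A => (complex.Re (quad (discrete_effect A) w))%:E) = msum m K.
  apply/funext => A; rewrite /msum quad_sum Re_sum big_mkcond -sumEFin.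
  apply: eq_bigr => i _; rewrite /m /= /mscale /= diracE.
  case: asboolP => Ai; first by rewrite mem_set // mule1.
  by rewrite memNset // mule0.
exact: measure_semi_sigma_additive.
Qed.

Definition discrete_povm : povm R nat #|bits Q| :=
  POVM discrete_effect_psd discrete_effect_setT discrete_effect_additive.

End DiscretePovm.

Section TensorPower.
Variables (R : realType) (m : nat) (Q : finType).

Definition uncopy (T : Type) (U : {ffun 'I_m -> {ffun Q -> T}}) :
  {ffun 'I_m * Q -> T} := [ffun x => U x.1 x.2].

Lemma copy_of_uncopy (T : Type) (U : {ffun 'I_m -> {ffun Q -> T}}) c :
  copy_of (uncopy U) c = U c.
Proof. by apply/ffunP => q; rewrite !ffunE. Qed.

Lemma uncopyK (T : Type) (u : {ffun 'I_m * Q -> T}) :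
  uncopy [ffun c => copy_of u c] = u.
Proof. by apply/ffunP => -[c q]; rewrite !ffunE. Qed.

Lemma sum_copies (V : nmodType) (F : bits ('I_m * Q)%type -> V) :
  \sum_u F u = \sum_(U : {ffun 'I_m -> bits Q}) F (uncopy U).
Proof.
rewrite (reindex (@uncopy bool)) //.
exists (fun u => [ffun c => copy_of u c]) => x _; last exact: uncopyK.
by apply/ffunP => c; rewrite ffunE copy_of_uncopy.
Qed.

Lemma prod_copies (S : comPzSemiRingType) (F : 'I_m -> Q -> S) :
  \prod_x F x.1 x.2 = \prod_c \prod_q F c q.
Proof. by rewrite pair_big. Qed.

Lemma born_tensor_power (rho : density R Q) (P : {ffun 'I_m * Q -> pauli})
    (s : bits ('I_m * Q)%type) :
  born (tensor_power m rho) (pauli_projection R P s) =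
  \prod_(c < m) born rho (pauli_projection R (copy_of P c) (copy_of s c)).
Proof.
rewrite /born.
have -> : \tr (tensor_power m rho *m pauli_projection R P s) =
    \prod_(c < m) \tr (rho *m pauli_projection R (copy_of P c) (copy_of s c)).
  pose h c u v := entry rho u v * \prod_q qubit_projection R (P (c, q)) (s (c, q)) (v q) (u q).
  rewrite trM_entry sum_copies.
  transitivity (\prod_c \sum_u \sum_v h c u v); last first.
    apply: eq_bigr => c _; rewrite trM_entry; apply: eq_bigr => u _.
    apply: eq_bigr => v _; rewrite entry_projection; congr (_ * _).
    by apply: eq_bigr => q _; rewrite !ffunE.
  rewrite (bigA_distr_bigA (fun c u => \sum_v h c u v)); apply: eq_bigr => U _ /=.
  rewrite sum_copies (bigA_distr_bigA (fun c v => h c (U c) v)); apply: eq_bigr => V _ /=.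
  rewrite /h big_split entry_mkop entry_projection /=; congr (_ * _).
    by apply: eq_bigr => c _; rewrite !copy_of_uncopy.
  rewrite -prod_copies; apply: eq_bigr => -[c q] _.
  by rewrite !ffunE.
(* The real part is not multiplicative in general; here each trace is nonnegative, hence real. *)
have tr_ge0 c := tr_projection_ge0 (copy_of P c) (copy_of s c) (density_psd rho).
rewrite (eq_bigr (fun c => (complex.Re (\tr (rho *m
  pauli_projection R (copy_of P c) (copy_of s c))))%:C%C)) => [|c _].
  by rewrite -rmorph_prod.
by rewrite ge0_ReK.
Qed.

End TensorPower.

Lemma born_sum (R : realType) (N : nat) (I : finType) (P : pred I) (A : 'M[R[i]]_N)
    (E : I -> 'M[R[i]]_N) :
  born A (\sum_(i | P i) E i) = \sum_(i | P i) born A (E i).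
Proof. by rewrite /born mulmx_sumr [\tr _]raddf_sum Re_sum. Qed.

(** The random choice of bases is absorbed into the effects: the projections scaled by [mu P] sum to
    the identity. *)
Lemma joint_of_pauli (R : realType) (n : nat) (I : finType) (F : I -> {set 'I_n})
    (eps delta : R) (m : nat) :
  pauli_achieves F eps delta m -> joint_achieves F eps delta m.
Proof.
move=> [mu [est [mu0 mu1 est_ok]]].
pose X : finType := ({ffun 'I_m * 'I_n -> pauli} * bits ('I_m * 'I_n)%type)%type.
(* Default for naturals beyond [#|X|], which carry no effect. *)
pose x0 : X := ([ffun=> PX], [ffun=> false]).
pose e (x : X) := (mu x.1)%:C%C *: pauli_projection R x.1 x.2.
pose outcome i : X := nth x0 (enum X) i.
have outcomeE (i : 'I_#|X|) : outcome i = enum_val i by rewrite /outcome -enum_val_nth.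
have e_psd i : psd (e (outcome i)) by apply: psdZ => //; exact: projection_psd.
have sumX (V : nmodType) (f : X -> V) : \sum_x f x = \sum_(i < #|X|) f (outcome i).
  rewrite (reindex (@enum_val X X)); last exact: onW_bij (@enum_val_bij X).
  by apply: eq_bigr => i _; rewrite outcomeE.
have e_sum : \sum_(i < #|X|) e (outcome i) = 1%:M.
  rewrite -sumX -(pair_bigA _ (fun P s => (mu P)%:C%C *: pauli_projection R P s)) /=.
  under eq_bigr do rewrite -scaler_sumr projection_sum.
  by rewrite -scaler_suml -rmorph_sum mu1 scale1r.
exists _, nat, (discrete_povm e_psd e_sum), (fun y => est (outcome y).1 (outcome y).2).
move=> rho; exists (fun y => accurate eps rho (est (outcome y).1 (outcome y).2)).
split=> //; apply: le_trans (est_ok rho) _; rewrite le_eqVlt; apply/orP; left; apply/eqP.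
rewrite /= /discrete_effect born_sum [RHS]big_mkcond /=.
under [LHS]eq_bigr do rewrite mulr_sumr big_mkcond.
rewrite pair_big /= (sumX R (fun x => if accurate eps rho (est x.1 x.2)
  then mu x.1 * pauli_prob rho x.1 x.2 else 0)).
apply: eq_bigr => i _; rewrite asboolb; case: ifP => // _.
rewrite /e /born -scalemxAr mxtraceZ ReZ; congr (_ * _).
exact/esym/born_tensor_power.
Qed.

(** * Joint measurements of product states *)

Section PovmDisjoint.
Variables (R : realType) (d : measure_display) (T : measurableType d) (N : nat).
Variables (E : povm R T N) (I : finType) (A : I -> set T) (w : 'cV[R[i]]_N).
Hypothesis A_meas : forall i, measurable (A i).
Hypothesis A_disj : forall i j y, A i y -> A j y -> i = j.

Lemma povm_disjoint_le :
  \sum_i complex.Re (quad (E (A i)) w) <= complex.Re (quad (1%:M : 'M[R[i]]_N) w).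
Proof.
(* The family becomes a partition of [T] indexed by naturals: [A i] at the rank of [i], the rest of
   [T] at [#|I|], empty sets beyond. The partial sum below [#|I|] is then at most the value on
   [T]. *)
pose D y : nat := oapp (fun i => enum_rank i : nat) #|I| [pick i | `[< A i y >]].
pose F k : set T := [set y | D y = k]%classic.
have FA i : F (enum_rank i) = A i.
  apply/seteqP; split=> y; rewrite /F /D /=; case: pickP => [j /asboolP Aj|noA] /=.
  - by move=> /val_inj/enum_rank_inj <-.
  - by move=> e; have := ltn_ord (enum_rank i); rewrite -e ltnn.
  - by move=> Ai; rewrite (A_disj Ai Aj).
  - by move=> Ai; have := noA i; rewrite asboolT.
have F_meas k : measurable (F k).
  have [kI|kI|->] := ltngtP k #|I|.
  - by rewrite -[k]/(val (Ordinal kI)) -(enum_valK (Ordinal kI)) FA.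
  - suff -> : F k = set0 by [].
    apply/seteqP; split=> y //; rewrite /F /D /=; case: pickP => [j _|_] /= e.
      by have := ltn_ord (enum_rank j); rewrite e => /(ltn_trans kI); rewrite ltnn.
    by rewrite e ltnn in kI.
  - suff -> : F #|I| = (~` \bigcup_(i in setT) A i)%classic.
      by apply: measurableC; exact: fin_bigcup_measurable.
    apply/seteqP; split=> y; rewrite /F /D /=; case: pickP => [j /asboolP Aj|noA] //=.
    + by move=> e; have := ltn_ord (enum_rank j); rewrite e ltnn.
    + by move=> _ [i _ Ai]; have := noA i; rewrite asboolT.
    + by case; exists j.
have F_triv : trivIset setT F by move=> i j _ _ [y [/= <- <-]].
have F_setT : (\bigcup_k F k)%classic = setT.
  by apply/seteqP; split=> y // _; exists (D y).
have := @effect_additive _ _ _ _ E w F F_meas F_triv.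
rewrite F_setT effect_setT => /(_ measurableT)/(cvg_lim (@ereal_hausdorff _)) limE.
have /= := @nneseries_lim_ge R (fun k => (complex.Re (quad (E (F k)) w))%:E) xpredT 0 #|I|.
rewrite limE sumEFin lee_fin => h; apply: le_trans (h _); last first.
  move=> k _ _; rewrite lee_fin; apply: Re_ge0.
  by have [_] := effect_psd E (F_meas k); apply.
rewrite big_mkord (reindex (@enum_rank I)); last exact: onW_bij (@enum_rank_bij I).
by rewrite le_eqVlt; apply/orP; left; apply/eqP/eq_bigr => i _; rewrite FA.
Qed.

End PovmDisjoint.

(** * Diagonal product states as independent coins *)

Section ProductStates.
Variables (R : realType) (n : nat) (J : finType) (a : J -> R).
Hypothesis a_le1 : forall j, `|a j| <= 1.

(** The diagonal of a qubit state whose Pauli Z expectation is [a j]. *)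
Definition coin (j : J) (x : bool) : R := (1 + (-1) ^+ x * a j) / 2.

Lemma coin_ge0 j x : 0 <= coin j x.
Proof.
have := a_le1 j; rewrite ler_norml => /andP[? ?].
by case: x; rewrite /coin ?expr1 ?expr0; apply: divr_ge0 => //; lra.
Qed.

Lemma coin_sum j : \sum_x coin j x = 1.
Proof. by rewrite sum_bool /coin expr1 expr0; lra. Qed.

Definition coins (b : {ffun 'I_n -> J}) (u : bits 'I_n) : R := \prod_q coin (b q) (u q).

Lemma coins_ge0 b u : 0 <= coins b u.
Proof. by apply: prodr_ge0 => q _; exact: coin_ge0. Qed.

Lemma coins_sum b : \sum_u coins b u = 1.
Proof.
rewrite -(bigA_distr_bigA (fun q x => coin (b q) x)) big1 // => q _.
exact: coin_sum.
Qed.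

Definition coin_state (b : {ffun 'I_n -> J}) : density R 'I_n :=
  diag_density (coins_ge0 b) (coins_sum b).

Lemma entry_coin_state b u v :
  entry (coin_state b) u v = (coins b u)%:C%C * (u == v)%:R.
Proof. exact: entry_mkop. Qed.

Lemma coins_bias b q : \sum_u coins b u * (-1) ^+ u q = a (b q).
Proof.
transitivity (\prod_q' \sum_x coin (b q') x * (if q' == q then (-1) ^+ x else 1)).
  rewrite (bigA_distr_bigA (fun q' (x : bool) =>
    coin (b q') x * (if q' == q then (-1) ^+ x else 1))).
  by apply: eq_bigr => u _; rewrite big_split /= -big_mkcond big_pred1_eq.
rewrite (bigD1 q) //= [X in _ * X]big1 => [|q' /negPf ->]; last first.
  by under eq_bigr do rewrite mulr1; exact: coin_sum.
by rewrite eqxx sum_bool /coin expr1 expr0; lra.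
Qed.

Lemma tensor_coin_state (m : nat) b (u v : bits ('I_m * 'I_n)%type) :
  entry (tensor_power m (coin_state b)) u v =
  (\prod_c coins b (copy_of u c))%:C%C * (u == v)%:R.
Proof.
rewrite entry_mkop.
under [LHS]eq_bigr do rewrite entry_coin_state.
rewrite big_split rmorph_prod; congr (_ * _).
have [->|uv] := eqVneq; first by rewrite big1 // => c _; rewrite eqxx.
have /existsP[x ux] : [exists x, u x != v x].
  apply: contraNT uv; rewrite negb_exists => /forallP h.
  by apply/eqP/ffunP => q; apply/eqP; have := h q; rewrite negbK.
rewrite (bigD1 x.1) //= (_ : _ == _ = false) ?mul0r //.
apply: contraNF ux => /eqP/ffunP/(_ x.2); rewrite !ffunE -surjective_pairing => ->.
by [].
Qed.

Section Phase.
Variables (S : {set 'I_n}) (q : subsystem S).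

(** Pauli Z on [q] and the identity on the rest of [S]: a unitary test that reads off the bias of
    [q]. *)
Definition phase : op R (subsystem S) :=
  mkop (fun x y => (-1) ^+ x q * (x == y)%:R).

Lemma phase_unitary : phase \is unitarymx.
Proof.
apply/unitarymxP/entryP => x y; rewrite entryM entry1 (bigD1 y) //= big1 => [|z zy].
  rewrite entry_adj !entry_mkop eqxx mulr1 addr0 rmorphXn rmorphN1.
  by case: eqVneq => [->|_]; rewrite ?mulr0 ?mul0r // mulr1 -expr2 sqrr_sign.
by rewrite entry_adj !entry_mkop eq_sym in zy *; rewrite (negPf zy) mulr0 rmorph0 mulr0.
Qed.

Lemma tr_phase (A : op R (subsystem S)) :
  \tr (A *m phase) = \sum_x entry A x x * (-1) ^+ x q.
Proof.
rewrite trM_entry; apply: eq_bigr => x _; rewrite (bigD1 x) //= big1 => [|y yx].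
  by rewrite addr0 entry_mkop eqxx mulr1.
by rewrite entry_mkop (negPf yx) !mulr0.
Qed.

Lemma tr_phase_coin b :
  complex.Re (\tr (reduced S (coin_state b) *m phase)) = a (b (val q)).
Proof.
rewrite tr_phase (tr_reducedM _ (fun x => (-1) ^+ x q)) -(coins_bias b) Re_sum.
apply: eq_bigr => u _; rewrite entry_coin_state eqxx mulr1 ReZ ffunE; congr (_ * _).
by case: (u _) => /=.
Qed.

End Phase.

(** Testing against [phase] and [- phase] shows that [sigma i] has a Z expectation within [eps] of
    both biases. *)
Lemma coin_state_separated (eps : R) (I : finType) (F : I -> {set 'I_n})
    (sigma : forall i, density R (subsystem (F i))) b b' i q :
  F i = [set q] -> accurate eps (coin_state b) sigma ->
  accurate eps (coin_state b') sigma -> a (b q) - a (b' q) < 2 * eps.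
Proof.
move=> Fi /forallP/(_ i) h /forallP/(_ i) h'.
have qF : q \in F i by rewrite Fi inE.
pose q0 : subsystem (F i) := exist _ q qF.
have Zu := phase_unitary q0.
have NZu : - phase q0 \is unitarymx.
  by rewrite qualifE /= linearN map_mxN mulmxN mulNmx opprK.
have := le_lt_trans (Re_tr_unitary_le _ Zu) h.
have := le_lt_trans (Re_tr_unitary_le _ NZu) h'.
have tr_sub (X Y Z : op R (subsystem (F i))) :
    complex.Re (\tr ((X - Y) *m Z)) = complex.Re (\tr (X *m Z)) - complex.Re (\tr (Y *m Z)).
  by rewrite mulmxBl [\tr _]raddfB ReB.
rewrite mulmxN [\tr _]raddfN ReN !tr_sub !tr_phase_coin /=.
by clear h h'; lra.
Qed.

(** Diagonal states see only the diagonal entries [W u b] of the effects, which sum over [b] to at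
    most 1 for each sample [u]. The total success over all [b] is thus at most the sum over [u] of a
    bound on the largest likelihood; [M] bounds it for a single coin. *)
Lemma joint_coin_bound (k : nat) (eps delta : R) (m : nat) (M : bits 'I_m -> R) :
  (0 < k)%N -> (forall i j, i != j -> 2 * eps <= `|a i - a j|) ->
  (forall z, 0 <= M z) -> (forall j (z : bits 'I_m), \prod_c coin j (z c) <= M z) ->
  joint_achieves (@small_set_val n k) eps delta m ->
  (1 - delta) * #|J|%:R ^+ n <= (\sum_z M z) ^+ n.
Proof.
move=> k0 a_sep M0 M_ge [d [T [E [est est_ok]]]].
have /choice[A A_ok] b := est_ok (coin_state b).
have A_meas b : measurable (A b) by case: (A_ok b).
have A_disj b b' y : A b y -> A b' y -> b = b'.
  have [_ acc _] := A_ok b; have [_ acc' _] := A_ok b' => /acc acc1 /acc' acc2.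
  (* If [b] and [b'] differ at [q], the singleton of [q], allowed since [0 < k], tells them
     apart. *)
  apply/ffunP => q; apply/eqP; apply: contraT => /a_sep.
  have qk : (#|[set q]| <= k)%N by rewrite cards1.
  pose i : small_set n k := exist _ [set q]%SET qk.
  have := @coin_state_separated _ _ _ _ _ _ i q erefl acc1 acc2.
  have := @coin_state_separated _ _ _ _ _ _ i q erefl acc2 acc1.
  by rewrite ler_normr => ? ? /orP[]; lra.
pose e (u : bits ('I_m * 'I_n)%type) : 'cV[R[i]]_#|bits ('I_m * 'I_n)%type| :=
  \col_x (x == enum_rank u)%:R.
have quad_e (B : op R ('I_m * 'I_n)%type) u : quad B (e u) = entry B u u.
  rewrite quad_entry (bigD1 u) //= [X in _ + X]big1 => [|v /negPf vu]; last first.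
    by rewrite big1 // => x _; rewrite mxE (inj_eq enum_rank_inj) vu conjC0 !mul0r.
  rewrite addr0 (bigD1 u) //= [X in _ + X]big1 => [|v /negPf vu]; last first.
    by rewrite [X in _ * X]mxE (inj_eq enum_rank_inj) vu mulr0.
  by rewrite !mxE eqxx conjC1 mul1r mulr1 addr0.
pose W u b := complex.Re (entry (E (A b)) u u).
have W0 u b : 0 <= W u b.
  by rewrite /W -quad_e; apply: Re_ge0; have [_] := effect_psd E (A_meas b); apply.
have W1 u : \sum_b W u b <= 1.
  have := povm_disjoint_le E (e u) A_meas A_disj.
  rewrite quad_e entry1 eqxx /=.
  by under eq_bigr do rewrite quad_e.
have bornE b : born (tensor_power m (coin_state b)) (E (A b)) =
    \sum_u (\prod_c coins b (copy_of u c)) * W u b.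
  rewrite /born trM_entry Re_sum; apply: eq_bigr => u _.
  rewrite (bigD1 u) //= big1 => [|v /negPf vu]; last first.
    by rewrite tensor_coin_state eq_sym vu mulr0 mul0r.
  by rewrite addr0 tensor_coin_state eqxx mulr1 ReZ.
(* The likelihood is regrouped by qubit instead of by copy. *)
pose column (u : bits ('I_m * 'I_n)%type) q : bits 'I_m := [ffun c => u (c, q)].
have coins_le b u : \prod_c coins b (copy_of u c) <= \prod_q M (column u q).
  rewrite /coins exchange_big /=; apply: ler_prod => q _.
  rewrite prodr_ge0 => [|c _]; last exact: coin_ge0.
  apply: le_trans (M_ge (b q) _); rewrite le_eqVlt; apply/orP; left; apply/eqP.
  by apply: eq_bigr => c _; rewrite !ffunE.
have -> : (1 - delta) * #|J|%:R ^+ n = \sum_(b : {ffun 'I_n -> J}) (1 - delta).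
  by rewrite sumr_const card_ffun card_ord -[RHS]mulr_natl natrX mulrC.
apply: (@le_trans _ _ (\sum_b \sum_u (\prod_q M (column u q)) * W u b)).
  apply: ler_sum => b _; have [_ _] := A_ok b; rewrite bornE => /le_trans; apply.
  by apply: ler_sum => u _; rewrite ler_wpM2r.
rewrite exchange_big /=.
apply: (@le_trans _ _ (\sum_u \prod_q M (column u q))).
  apply: ler_sum => u _; rewrite -mulr_sumr ler_piMr // prodr_ge0 //.
rewrite le_eqVlt; apply/orP; left; apply/eqP.
rewrite -[n in RHS]card_ord -prodr_const bigA_distr_bigA /=.
pose rows (f : {ffun 'I_n -> bits 'I_m}) : bits ('I_m * 'I_n)%type := [ffun x => f x.2 x.1].
rewrite (reindex rows).
  apply: eq_bigr => f _; apply: eq_bigr => q _; congr M.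
  by apply/ffunP => c; rewrite !ffunE.
exists (fun u => [ffun q => column u q]) => [f|u] _.
  by apply/ffunP => q; apply/ffunP => c; rewrite !ffunE.
by apply/ffunP => -[c q]; rewrite !ffunE.
Qed.

End ProductStates.

(** * The lower bound *)

Lemma one_add_pow_le_expR (R : realType) (x : R) (m : nat) : 0 <= x ->
  (1 + x) ^+ m <= expR (m%:R * x).
Proof.
move=> x0; rewrite expRM_natl; apply: lerXn2r; rewrite ?nnegrE ?expR_ge0 ?expR_ge1Dx //.
lra.
Qed.

(** Induction: the factor [1 - h] turns [1 + n.+1%:R * h] into [1 + n%:R * h] minus
    [n.+1%:R * h ^+ 2]. *)
Lemma mul_one_sub_pow_le1 (R : realType) (h : R) (n : nat) : 0 <= h <= 1 ->
  (1 + n%:R * h) * (1 - h) ^+ n <= 1.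
Proof.
move=> /andP[h0 h1]; elim: n => [|n IH]; first by rewrite mul0r addr0 mul1r.
apply: le_trans IH; rewrite exprS mulrA; apply: ler_wpM2r.
  by apply: exprn_ge0; lra.
have n0 : 0 <= n%:R :> R by [].
have : 0 <= n.+1%:R * h ^+ 2 by rewrite mulr_ge0 ?sqr_ge0.
by rewrite -natr1; nra.
Qed.

Section LowerBound.
Variables (R : realType) (k n m : nat) (eps delta : R).
Hypotheses (k_gt0 : (0 < k)%N) (n_gt0 : (0 < n)%N).
Hypotheses (eps_gt0 : 0 < eps) (eps_le : eps <= 2^-1).
Hypotheses (delta_gt0 : 0 < delta) (delta_le : delta <= 2^-1).
Hypothesis achieves : joint_achieves (@small_set_val n k) eps delta m.

Lemma sqr_eps_le : eps ^+ 2 <= 4^-1.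
Proof.
have : 0 <= (2^-1 - eps) * (2^-1 + eps).
  by apply: mulr_ge0; rewrite ?subr_ge0 ?addr_ge0 ?invr_ge0 ?(ltW eps_gt0).
by lra.
Qed.

Lemma coin_prod_sum (J : finType) (a : J -> R) j :
  \sum_(z : bits 'I_m) \prod_c coin a j (z c) = 1.
Proof.
rewrite -(bigA_distr_bigA (fun _ x => coin a j x)) big1 // => c _; exact: coin_sum.
Qed.

(** The product of the likelihoods of the biases [eps] and [- eps] is constant. *)
Lemma pow_le_of_two_coins : n%:R * (1 - eps ^+ 2) ^+ m <= 8 * delta.
Proof.
have [e0 e1 d0 d1] := And4 eps_gt0 eps_le delta_gt0 delta_le.
pose a (b : bool) := if b then eps else - eps.
have a_le1 b : `|a b| <= 1 by rewrite ler_norml /a; apply/andP; case: b; split => /=; lra.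
have a_sep (i j : bool) : i != j -> 2 * eps <= `|a i - a j|.
  by case: i j => [] [] // _; rewrite /a ler_normr; apply/orP; [left|right]; lra.
pose P b (z : bits 'I_m) := \prod_c coin a b (z c).
have P_ge0 b z : 0 <= P b z by apply: prodr_ge0 => c _; exact: coin_ge0.
pose M z := Num.max (P true z) (P false z).
have M_ge0 z : 0 <= M z by rewrite le_max P_ge0.
have M_ge b z : P b z <= M z by rewrite le_max; case: b; rewrite lexx ?orbT.
have := joint_coin_bound a_le1 k_gt0 a_sep M_ge0 M_ge achieves.
rewrite card_bool; set s := \sum_z M z => bound.
pose g := (1 - eps ^+ 2) ^+ m.
have eps2 := sqr_eps_le.
have g0 : 0 <= g by apply: exprn_ge0; lra.
have g1 : g <= 1 by apply: exprn_ile1; have := sqr_ge0 eps; lra.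
pose t : R := 2 ^+ m.
have PP z : P true z * P false z = g / (t * t).
  rewrite /P -big_split /= (eq_bigr (fun=> (1 - eps ^+ 2) / 4)) => [|c _]; last first.
    by rewrite /coin /a; case: (z c); rewrite ?expr1 ?expr0; field.
  by rewrite prodr_const card_ord expr_div_n /g /t -exprMn; congr (_ / _ ^+ _); ring.
have t0 : 0 < t by rewrite exprn_gt0.
have P_sum b : \sum_z P b z = 1 by exact: coin_prod_sum.
have s2 : s <= 2.
  rewrite (_ : 2 = \sum_z (P true z + P false z)); last by rewrite big_split !P_sum.
  apply: ler_sum => z _; rewrite /M ge_max.
  by have := P_ge0 true z; have := P_ge0 false z; lra.
(* [P true z + P false z - M z] is the smaller likelihood [g / (t * t) / M z]; bound
   [1 / M z] below by its tangent at [M z = 2 / t]. *)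
have step z : P true z + P false z - M z >= g / t - M z * (g / 4).
  have [x [x0 xM ->]] : exists x, [/\ 0 <= x, x * M z = g / (t * t) &
      P true z + P false z - M z = x].
    rewrite /M -(PP z); case: leP => _.
      by exists (P true z); split => //; ring.
    by exists (P false z); split => //; ring.
  have : 0 <= x * (1 - M z * (t / 2)) ^+ 2 by rewrite mulr_ge0 ?sqr_ge0.
  have -> : x * (1 - M z * (t / 2)) ^+ 2 =
      x - (x * M z) * t + (x * M z) * M z * (t * t) / 4 by field.
  rewrite xM.
  have -> : g / (t * t) * t = g / t by field; rewrite gt_eqF.
  have -> : g / (t * t) * M z * (t * t) / 4 = M z * (g / 4) by field; rewrite gt_eqF.
  by lra.
(* Summing [step] over the [t] samples gives [s <= 2 - g + s * g / 4], where [s <= 2] is used on the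
   right. *)
have s_le : s <= 2 * (1 - g / 4).
  have : \sum_(z : bits 'I_m) (g / t - M z * (g / 4)) <=
      \sum_z (P true z + P false z - M z) by apply: ler_sum => z _; exact: step.
  rewrite !sumrB big_split /= !P_sum sumr_const card_ffun card_bool card_ord.
  rewrite -[(g / t) *+ _]mulr_natl natrX -/t -mulr_suml -/s.
  have -> : t * (g / t) = g by field; rewrite gt_eqF.
  nra.
have s0 : 0 <= s by apply: sumr_ge0 => z _.
pose h := g / 4.
have h01 : 0 <= h <= 1 by apply/andP; split; rewrite /h; lra.
have le_h : 1 - delta <= (1 - h) ^+ n.
  have : (1 - delta) * 2 ^+ n <= (2 * (1 - h)) ^+ n.
    apply: le_trans bound _; apply: lerXn2r; rewrite ?nnegrE //.
    by rewrite /h; lra.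
  by rewrite exprMn [leRHS]mulrC ler_pM2r ?exprn_gt0.
have := mul_one_sub_pow_le1 n h01.
have nh0 : 0 <= n%:R * h by rewrite mulr_ge0 //; case/andP: h01.
have : (1 + n%:R * h) * (1 - delta) <= (1 + n%:R * h) * (1 - h) ^+ n.
  by rewrite ler_wpM2l //; lra.
move=> h1 h2; have {h1 h2} h3 := le_trans h1 h2.
(* From [n%:R * h * (1 - delta) <= delta] and [1 - delta >= 2^-1]. *)
have : n%:R * h <= 2 * delta by nra.
by rewrite /h -/g; lra.
Qed.

(** Three biases are needed here: if [delta = 2^-1], one of two states can be guessed
    without any copy. *)
Lemma pow_ge_of_three_coins : 67 / 64 <= (1 + 4 * eps ^+ 2) ^+ m.
Proof.
have [e0 e1 d0 d1] := And4 eps_gt0 eps_le delta_gt0 delta_le.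
(* The biases are [- 2 * eps], [0] and [2 * eps], in range because [eps <= 2^-1]. *)
pose a (j : 'I_3) : R := 2 * eps * ((j : nat)%:R - 1).
have a_le1 j : `|a j| <= 1.
  by rewrite ler_norml /a; apply/andP; case: j => -[|[|[|//]]] ?; split => /=; lra.
have a_sep i j : i != j -> 2 * eps <= `|a i - a j|.
  rewrite -val_eqE ler_normr /a; case: i j => -[|[|[|//]]] ? [] [|[|[|//]]] ? //= _;
  apply/orP; (try by left; lra); right; lra.
pose P j (z : bits 'I_m) := \prod_c coin a j (z c).
pose t : R := 2 ^+ m.
have t0 : 0 < t by rewrite exprn_gt0.
(* The AM-GM bound on [P j z - t^-1]: the sum of [f j] over [z] is a chi-squared
   divergence, which factorizes over the copies. *)
pose f j z : R := 4 * t * (P j z - t^-1) ^+ 2 + t^-1 / 16.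
have f0 j z : 0 <= f j z.
  apply: addr_ge0; first by rewrite mulr_ge0 ?sqr_ge0 // mulr_ge0 // ltW.
  by rewrite divr_ge0 // invr_ge0 ltW.
pose j0 : 'I_3 := inord 0; pose j2 : 'I_3 := inord 2.
pose M z := t^-1 + f j0 z + f j2 z.
have ti0 : 0 <= t^-1 by rewrite invr_ge0 ltW.
have M_ge0 z : 0 <= M z by exact: addr_ge0 (addr_ge0 ti0 (f0 j0 z)) (f0 j2 z).
have fP j z : P j z <= t^-1 + f j z.
  have : 0 <= t * (2 * (P j z - t^-1) - t^-1 / 4) ^+ 2.
    by rewrite mulr_ge0 ?sqr_ge0 // ltW.
  have -> : t * (2 * (P j z - t^-1) - t^-1 / 4) ^+ 2 =
     4 * t * (P j z - t^-1) ^+ 2 - (P j z - t^-1) + t^-1 / 16.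
    by field; rewrite gt_eqF.
  by rewrite /f; lra.
have M_ge j z : P j z <= M z.
  have [j1|[e|e]] : (j : nat) = 1%N \/ j = j0 \/ j = j2.
    case: j => -[|[|[|//]]] i; [right; left|by left|right; right];
    by apply: val_inj; rewrite /= inordK.
  - have -> : P j z = t^-1.
      rewrite /P (eq_bigr (fun=> 2^-1)) => [|c _].
        by rewrite prodr_const card_ord exprVn.
      by rewrite /coin /a j1 subrr !mulr0 addr0 mul1r.
    by have := f0 j0 z; have := f0 j2 z; rewrite /M; lra.
  - by rewrite e; have := fP j0 z; have := f0 j2 z; rewrite /M; lra.
  - by rewrite e; have := fP j2 z; have := f0 j0 z; rewrite /M; lra.
have := joint_coin_bound a_le1 k_gt0 a_sep M_ge0 M_ge achieves.
rewrite card_ord; set s := \sum_z M z => bound.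
have s0 : 0 <= s by apply: sumr_ge0.
(* The bound says [(s / 3) ^+ n >= 1 - delta >= 2^-1], which [s / 3 < 2^-1] would violate already at
   [n = 1]. *)
have s_ge : 3 / 2 <= s.
  rewrite leNgt; apply/negP => s3.
  have n1 : n = n.-1.+1 by rewrite prednK.
  have : s ^+ n < 2^-1 * 3 ^+ n.
    rewrite n1 !exprS mulrA.
    apply: (@le_lt_trans _ _ (s * 3 ^+ n.-1)).
      by rewrite ler_wpM2l // lerXn2r ?nnegrE //; lra.
    by rewrite ltr_pM2r ?exprn_gt0 //; lra.
  move=> /(le_lt_trans bound); rewrite ltr_pM2r ?exprn_gt0 //; lra.
have const_sum (x : R) : \sum_(z : bits 'I_m) x = t * x.
  by rewrite sumr_const card_ffun card_bool card_ord -[LHS]mulr_natl natrX.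
have f_sum j : (a j) ^+ 2 = 4 * eps ^+ 2 ->
    \sum_z f j z = 4 * ((1 + 4 * eps ^+ 2) ^+ m - 1) + 16^-1.
  move=> aj.
  have P2 : t * \sum_z P j z ^+ 2 = (1 + 4 * eps ^+ 2) ^+ m.
    under eq_bigr do rewrite /P -prodrXl.
    rewrite -(bigA_distr_bigA (fun _ x => coin a j x ^+ 2)) prodr_const card_ord.
    by rewrite /t -exprMn; congr (_ ^+ _); rewrite sum_bool /coin expr1 expr0 -aj; field.
  transitivity (4 * (t * \sum_z P j z ^+ 2) - 8 * (t * t^-1) * \sum_z P j z
     + 4 * (t * t^-1) * (t * t^-1) + (t * t^-1) / 16).
    rewrite /f big_split /= const_sum; congr (_ + _); last by rewrite mulrA.
    transitivity (\sum_z (4 * t * P j z ^+ 2 - 8 * (t * t^-1) * P j z + 4 * (t * t^-1) * t^-1)).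
      by apply: eq_bigr => z _; ring.
    rewrite big_split sumrB /= const_sum -!mulr_sumr; ring.
  by rewrite P2 coin_prod_sum divff ?gt_eqF //; lra.
(* Writing [x] for [(1 + 4 * eps ^+ 2) ^+ m], [s >= 3 / 2] becomes [8 * (x - 1) >= 3 / 8], that is
   [x >= 67 / 64]. *)
have sE : s = 1 + 2 * (4 * ((1 + 4 * eps ^+ 2) ^+ m - 1) + 16^-1).
  have -> : s = \sum_(z : bits 'I_m) t^-1 + \sum_z f j0 z + \sum_z f j2 z.
    by rewrite -!big_split.
  rewrite const_sum divff ?gt_eqF // (f_sum j0) ?(f_sum j2); first by ring.
  - by rewrite /a inordK //; ring.
  - by rewrite /a inordK //; ring.
by lra.
Qed.

(** Two coins give the logarithmic growth once [n%:R / delta] is large; below that the logarithm is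
    bounded and three coins give [m] of order [1 / eps ^+ 2]. *)
Lemma joint_lower_bound :
  Num.min 4^-1 (ln (67 / 64) / (4 * ln 64)) * (ln (n%:R / delta) / eps ^+ 2) <= m%:R.
Proof.
have [e0 e1 d0 d1] := And4 eps_gt0 eps_le delta_gt0 delta_le.
have e2 : 0 < eps ^+ 2 by rewrite exprn_gt0.
have n1 : 1 <= n%:R :> R by rewrite ler1n.
have nd : 1 < n%:R / delta by rewrite ltr_pdivlMr //; lra.
have ln0 : 0 < ln (n%:R / delta) by rewrite ln_gt0.
have nd0 : 0 < n%:R / delta by lra.
rewrite mulrA ler_pdivrMr //.
(* The threshold is [8 ^+ 2], so that [ln 8] takes at most half of the logarithm. *)
have [big|small] := leP 64 (n%:R / delta).
  apply: (@le_trans _ _ (4^-1 * ln (n%:R / delta))).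
    by rewrite ler_pM2r // ge_min lexx.
  (* [(1 - eps ^+ 2) * (1 + 2 * eps ^+ 2) >= 1] for [eps ^+ 2 <= 4^-1]. *)
  have E : 1 <= (1 - eps ^+ 2) ^+ m * expR (m%:R * (2 * eps ^+ 2)).
    have eps2 := sqr_eps_le.
    rewrite (le_trans _ (ler_wpM2l _ (one_add_pow_le_expR m _))) //; last 2 first.
    - by apply: exprn_ge0; lra.
    - by lra.
    by rewrite -exprMn exprn_ege1 //; nra.
  have L : n%:R / delta <= 8 * expR (m%:R * (2 * eps ^+ 2)).
    rewrite ler_pdivrMr //; set x := expR _ in E *.
    have x0 : 0 <= x by exact: expR_ge0.
    have := pow_le_of_two_coins; set g := (1 - eps ^+ 2) ^+ m in E *; move=> ng.
    have : n%:R * 1 <= n%:R * (g * x) by rewrite ler_wpM2l.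
    have : n%:R * g * x <= 8 * delta * x by rewrite ler_wpM2r.
    by rewrite mulr1 mulrA; lra.
  have l8 : 2 * ln 8 <= ln (n%:R / delta).
    rewrite mulr_natl -lnXn // ler_ln ?posrE //.
    by apply: le_trans big; lra.
  have : ln (n%:R / delta) <= ln 8 + m%:R * (2 * eps ^+ 2).
    rewrite -[X in _ + X]expRK -lnM ?posrE ?expR_gt0 // ler_ln ?posrE //.
    by rewrite mulr_gt0 ?expR_gt0.
  by lra.
have l64 : 0 < ln 64 :> R by rewrite ln_gt0 //; lra.
apply: (@le_trans _ _ (ln (67 / 64) / (4 * ln 64) * ln (n%:R / delta))).
  by rewrite ler_pM2r // ge_min lexx orbT.
have l67 : 0 < ln (67 / 64) :> R by rewrite ln_gt0 //; lra.
apply: (@le_trans _ _ (ln (67 / 64) / (4 * ln 64) * ln 64)).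
  apply: ler_wpM2l; first by apply: divr_ge0; lra.
  by rewrite ler_ln ?posrE //; exact: ltW.
have -> : ln (67 / 64) / (4 * ln 64) * ln 64 = ln (67 / 64) / 4 :> R.
  by field; rewrite gt_eqF.
have : ln (67 / 64) <= m%:R * (4 * eps ^+ 2).
  rewrite -[leRHS]expRK ler_ln ?posrE ?expR_gt0 //.
  by apply: le_trans pow_ge_of_three_coins (one_add_pow_le_expR _ _); lra.
by lra.
Qed.

End LowerBound.

(** * The theorem *)

Lemma superset_of_card (T : finType) (S : {set T}) (d : nat) :
  (#|S| + d <= #|T|)%N -> exists S' : {set T}, S \subset S' /\ #|S'| = (#|S| + d)%N.
Proof.
elim: d => [|d IH] Sd; first by exists S; rewrite addn0.
have [|S' [SS' cS']] := IH; first by lia.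
have /existsP[x xS'] : [exists x, x \notin S'].
  apply: contraTT Sd; rewrite negb_exists => /forallP all; rewrite -ltnNge.
  have -> : #|T| = #|S'|.
    by apply: eq_card => x; have := all x; rewrite negbK => ->.
  by rewrite cS'; lia.
exists (x |: S'); split; last by rewrite cardsU1 xS' cS'; lia.
exact: fintype.subset_trans SS' (finset.subsetUr _ _).
Qed.

Lemma bin_le_expn (n k : nat) : ('C(n, k) <= n ^ k)%N.
Proof.
apply: (@leq_trans (n ^_ k)).
  by rewrite -bin_ffact leq_pmulr // fact_gt0.
elim: k => [|k IH]; first by rewrite ffactn0.
by rewrite ffactnSr expnSr leq_mul // leq_subr.
Qed.

(** The covering sets are those of exactly [k] qubits; smaller sets extend to such a set because
    [k <= n]. *)
Lemma small_set_tomography (R : realType) (n k : nat) (eps delta : R) :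
  (k <= n)%N -> 0 < eps -> 0 < delta -> delta < 1 ->
  exists m : nat, pauli_achieves (@small_set_val n k) eps delta m /\
    m%:R <= 1040 * (10 ^+ k * ln (2 * 'C(n, k)%:R / delta) / eps ^+ 2).
Proof.
move=> kn e0 d0 d1.
pose J : finType := {S : {set 'I_n} | #|S| == k}.
have cJ : #|J| = 'C(n, k).
  by rewrite card_sig -[in RHS](card_ord n) -card_draws; apply: eq_card => S; rewrite !inE.
have sup (S : small_set n k) : exists j : J, small_set_val S \subset val j.
  have [|S' [SS' cS']] := @superset_of_card _ (val S) (k - #|val S|).
    by rewrite card_ord subnKC // (valP S).
  have S'k : #|S'| == k by rewrite cS' subnKC // (valP S).
  by exists (exist _ S' S'k).
have [g gP] := choice sup.
rewrite -cJ; apply: (pauli_tomography gP) => //.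
  by move=> j; rewrite (eqP (valP j)).
by rewrite cJ bin_gt0.
Qed.

Lemma sample_complexity_exists (achieves : nat -> Prop) (m : nat) :
  achieves m -> exists2 N, sample_complexity achieves N & (N <= m)%N.
Proof.
move=> am.
have ex : exists m, `[< achieves m >] by exists m; exact/asboolP.
case: (ex_minnP ex) => N /asboolP aN N_min.
exists N; last by apply: N_min; exact/asboolP.
by split=> // m' am'; apply: N_min; exact/asboolP.
Qed.

Theorem theorem2 (R : realType) :
  (forall k : nat, (1 <= k)%N ->
   exists c C : R, [/\ 0 < c, 0 < C &
   forall (n : nat) (eps delta : R),
     (k <= n)%N -> 0 < eps -> 0 < delta -> delta < 1 ->
     (1 < n)%N \/ delta <= 2^-1 ->
     exists N : nat,
       [/\ sample_complexity
             (joint_achieves (@small_set_val n k) eps delta) N,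
           N%:R <= C * (ln (n%:R / delta) / eps ^+ 2) &
           eps <= 2^-1 -> delta <= 2^-1 ->
             c * (ln (n%:R / delta) / eps ^+ 2) <= N%:R]])
  /\
  (exists C : R, 0 < C /\
   forall (n k : nat) (eps delta : R),
     (1 <= k)%N -> (k <= n)%N -> 0 < eps -> 0 < delta -> delta < 1 ->
     (k < n)%N \/ delta <= 2^-1 ->
     exists m : nat,
       pauli_achieves (@small_set_val n k) eps delta m /\
       m%:R <= C * (10 ^+ k * ln ('C(n, k)%:R / delta) / eps ^+ 2))
  /\
  (exists C : R, 0 < C /\
   forall (n k M : nat) (S : 'I_M -> {set 'I_n}) (eps delta : R),
     (1 <= k)%N -> (k <= n)%N -> (1 <= M)%N -> (forall i, (#|S i| <= k)%N) ->
     0 < eps -> 0 < delta -> delta < 1 ->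
     exists N : nat,
       sample_complexity (pauli_achieves S eps delta) N /\
       N%:R <= C * (10 ^+ k * ln (2 * M%:R / delta) / eps ^+ 2)).
Proof.
(* The side conditions keep the argument of the logarithm at least 2, so that the factor 2 inside it
   can be absorbed. *)
have two_le (x delta : R) : 0 < delta -> delta < 1 -> 1 <= x ->
    2 <= x \/ delta <= 2^-1 -> 2 <= x / delta.
  by move=> d0 d1 x1 h; rewrite ler_pdivlMr //; case: h; nra.
split; [move=> k k1|split].
- pose c0 : R := Num.min 4^-1 (ln (67 / 64) / (4 * ln 64)).
  have c0_gt0 : 0 < c0.
    rewrite lt_min invr_gt0 ltr0n /=.
    apply: divr_gt0; first by rewrite ln_gt0 //; lra.
    by apply: mulr_gt0 => //; rewrite ln_gt0 //; lra.
  exists c0, (1040 * 10 ^+ k * k.+1%:R); split; first exact: c0_gt0.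
    by apply: mulr_gt0 (ltr0Sn _ _); apply: mulr_gt0 (exprn_gt0 _ (ltr0Sn _ _)); lra.
  move=> n eps delta kn e0 d0 d1 nd.
  have n0 : (0 < n)%N := leq_trans k1 kn.
  have n1 : 1 <= n%:R :> R by rewrite ler1n.
  have nd2 : 2 <= n%:R / delta.
    by apply: two_le => //; case: nd => [n2|]; [left; rewrite ler_nat|right].
  have [m [/joint_of_pauli am mle]] := small_set_tomography kn e0 d0 d1.
  have [N N_min Nm] := sample_complexity_exists am.
  exists N; split; [exact: N_min| |]; last first.
    by move=> e1 d2; case: N_min => aN _; exact: joint_lower_bound aN.
  have mN : N%:R <= m%:R :> R by rewrite ler_nat.
  apply: le_trans (le_trans mN mle) _.
  (* [2 <= n%:R / delta] and ['C(n, k) <= n ^ k] bound the argument by [(n%:R / delta) ^+ k.+1];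
     hence the factor [k.+1] in the constant. *)
  have lnB : ln (2 * 'C(n, k)%:R / delta) <= k.+1%:R * ln (n%:R / delta).
    rewrite [leRHS]mulr_natl -lnXn; last by lra.
    have B1 : 1 <= 'C(n, k)%:R :> R by rewrite ler1n bin_gt0.
    have Bd : 0 < 'C(n, k)%:R / delta by apply: divr_gt0 => //; lra.
    rewrite ler_ln ?posrE; [|by lra|by apply: exprn_gt0; lra].
    rewrite exprS -mulrA; apply: ler_pM => //; first exact: ltW.
    apply: (@le_trans _ _ (n%:R ^+ k / delta)).
      by rewrite ler_pM2r ?invr_gt0 // -natrX ler_nat bin_le_expn.
    rewrite expr_div_n ler_pM2l ?exprn_gt0 //; last by lra.
    rewrite lef_pV2 ?posrE ?exprn_gt0 //.
    by rewrite -[leRHS]expr1 ler_wiXn2l // ltW.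
  have e2 : 0 < eps ^+ 2 by exact: exprn_gt0.
  have k10 : 0 < 10 ^+ k :> R by exact: exprn_gt0.
  rewrite -!mulrA ler_pM2l; last by lra.
  by rewrite ler_pM2l // [leRHS]mulrA ler_pM2r ?invr_gt0 // mulrA.
- exists 2080; split; first by lra.
  move=> n k eps delta k1 kn e0 d0 d1 kd.
  have [m [am mle]] := small_set_tomography kn e0 d0 d1.
  exists m; split; first exact: am.
  apply: le_trans mle _.
  have B1 : 1 <= 'C(n, k)%:R :> R by rewrite ler1n bin_gt0.
  (* For [k < n] the binomial is at least ['C(k.+1, k) = k.+1]. *)
  have Bd2 : 2 <= 'C(n, k)%:R / delta.
    apply: two_le => //; case: kd => [kn'|]; [left|by right].
    rewrite ler_nat; apply: leq_trans (leq_bin2l _ kn').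
    by rewrite binSn.
  (* [2 * x <= x ^+ 2] for [x >= 2], which doubles 1040 to 2080. *)
  have lnB : ln (2 * 'C(n, k)%:R / delta) <= 2 * ln ('C(n, k)%:R / delta).
    rewrite [leRHS]mulr_natl -lnXn; last by lra.
    rewrite ler_ln ?posrE; [|by lra|by apply: exprn_gt0; lra].
    by rewrite -mulrA expr2 ler_pM2r //; lra.
  have e2 : 0 < eps ^+ 2 by exact: exprn_gt0.
  have k10 : 0 < 10 ^+ k :> R by exact: exprn_gt0.
  have a0 : 0 < 10 ^+ k / eps ^+ 2 by exact: divr_gt0.
  have := ler_wpM2l (ltW a0) lnB.
  by rewrite ![10 ^+ k * _ / _]mulrAC; lra.
- exists 1040; split; first by lra.
  move=> n k M S eps delta k1 kn M1 Sk e0 d0 d1.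
  have J0 : (0 < #|'I_M|)%N by rewrite card_ord.
  (* Each prescribed set covers itself, so the union bound runs over [M] sets only. *)
  have SS i : S i \subset S (id i) by [].
  have [m [am mle]] := pauli_tomography SS Sk e0 J0 d0 d1.
  have [N N_min Nm] := sample_complexity_exists am.
  exists N; split; first exact: N_min.
  rewrite card_ord in mle.
  by apply: le_trans mle; rewrite ler_nat.
Qed.
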